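(* Let $\omega^{XBR}=\sum_xp(x)|x\rangle\langle x|^X\otimes|\psi_x\rangle\langle\psi_x|^{BR}$. In the unassisted model there exists a sequence of side information codes (see context) compressing $B^n$ at asymptotic qubit rate \[ R_B=\tfrac12\big(S(B)+S(B|X)\big), \] entropies being with respect to $\omega^{XBR}$.
   Context: $\mathcal X$ is a finite alphabet, $p$ a distribution, $|\psi_x\rangle\in B\otimes R$ finite-dimensional. Extended source: $\omega^{X^nX'^nB^nR^n}=\sum_{x^n}p(x^n)|x^n\rangle\langle x^n|^{X^n}\otimes|x^n\rangle\langle x^n|^{X'^n}\otimes\psi_{x^n}^{B^nR^n}$. An unassisted side information code of block length $n$: Bob applies a CPTP map $\mathcal E_B:B^n\to C$, and the decoder, who holds $X^n$, applies a CPTP map $\mathcal D:X^nC\to\hat X^n\hat B^n$; it has error $\epsilon$ if $F\big(\omega^{X^nX'^nB^nR^n},(\mathcal D\circ(\mathrm{id}_{X^n}\otimes\mathcal E_B)\otimes\mathrm{id}_{X'^nR^n})\omega^{X^nX'^nB^nR^n}\big)\ge1-\epsilon$, $F(\rho,\sigma)=\|\sqrt\rho\sqrt\sigma\|_1$. A sequence of codes achieves rate $R_B$ if the error tends to $0$ and $\frac1n\log|C|\to R_B$. *)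

(* Defs.v *)
From HB Require Import structures.
From mathcomp Require Import all_boot all_order all_algebra.
From mathcomp Require Import all_classical all_reals.
From mathcomp Require Import exp sequences topology normedtype.
From mathcomp.real_closed Require Import complex.
From Stdlib Require Import ClassicalEpsilon.

Set Implicit Arguments.
Unset Strict Implicit.
Unset Printing Implicit Defensive.

Import Order.TTheory GRing.Theory Num.Theory.
Local Open Scope ring_scope.

(* Finite-dimensional quantum systems.  A system is a finite type T
   (an orthonormal basis index); vectors are T -> C, operators are
   matrices indexed by T, i.e. functions T -> T -> C.  The composite
   system A (x) E is the product type A * E.                           *)

Section QuantumDefs.
Variable R : realType.
Local Notation C := R[i].

Definition qvec (T : finType) := T -> C.
Definition op (T : finType) := T -> T -> C.

Definition opmul (T : finType) (M N : op T) : op T :=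
  fun i j => \sum_(k : T) M i k * N k j.

Definition opadj (T : finType) (M : op T) : op T :=
  fun i j => (M j i)^*.

Definition optr (T : finType) (M : op T) : C := \sum_(i : T) M i i.

(* positive semidefinite: <v, M v> >= 0 for every vector v
   (over C this also forces M to be Hermitian) *)
Definition psd (T : finType) (M : op T) : Prop :=
  forall v : qvec T, 0 <= \sum_(i : T) \sum_(j : T) (v i)^* * M i j * v j.

Definition opsqrt (T : finType) (M : op T) : op T :=
  epsilon (inhabits (fun _ _ => 0)) (fun Y : op T => psd Y /\ opmul Y Y = M).

Definition trnorm (T : finType) (M : op T) : R :=
  complex.Re (optr (opsqrt (opmul (opadj M) M))).

Definition fidelity (T : finType) (rho sigma : op T) : R :=
  trnorm (opmul (opsqrt rho) (opsqrt sigma)).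

Definition ptrace_r (A E : finType) (M : op (A * E)%type) : op A :=
  fun a a' => \sum_(e : E) M (a, e) (a', e).
Definition ptrace_l (E A : finType) (M : op (E * A)%type) : op A :=
  fun a a' => \sum_(e : E) M (e, a) (e, a').

Definition mx_of_op (T : finType) (M : op T) : 'M[C]_#|T| :=
  \matrix_(i, j) M (enum_val i) (enum_val j).

(* eigenvalues, with multiplicity: the roots of the characteristic
   polynomial (which splits over the algebraically closed field C) *)
Definition eigenvalues (T : finType) (M : op T) : seq C :=
  epsilon (inhabits [::])
    (fun rs : seq C => char_poly (mx_of_op M) = \prod_(r <- rs) ('X - r%:P)).

Definition log2 (x : R) : R := ln x / ln 2.

Definition etaf (t : R) : R := if t <= 0 then 0 else - (t * log2 t).

Definition vN_entropy (T : finType) (rho : op T) : R :=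
  \sum_(r <- eigenvalues rho) etaf (complex.Re r).

Definition linear_map (A B : finType) (Phi : op A -> op B) : Prop :=
  forall (c : C) (M N : op A),
    Phi (fun i j => c * M i j + N i j) = (fun i j => c * Phi M i j + Phi N i j).

(* Phi (x) id_E acting on A (x) E  (uses linearity of Phi, blockwise) *)
Definition lift_l (A B E : finType) (Phi : op A -> op B) (M : op (A * E)%type)
  : op (B * E)%type :=
  fun be be' => Phi (fun a a' => M (a, be.2) (a', be'.2)) be.1 be'.1.

Definition lift_r (E A B : finType) (Phi : op A -> op B) (M : op (E * A)%type)
  : op (E * B)%type :=
  fun eb eb' => Phi (fun a a' => M (eb.1, a) (eb'.1, a')) eb.2 eb'.2.

Definition completely_positive (A B : finType) (Phi : op A -> op B) : Prop :=
  forall (k : nat) (M : op (A * 'I_k)%type), psd M -> psd (lift_l Phi M).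

Definition trace_preserving (A B : finType) (Phi : op A -> op B) : Prop :=
  forall M : op A, optr (Phi M) = optr M.

Definition CPTP (A B : finType) (Phi : op A -> op B) : Prop :=
  [/\ linear_map Phi, completely_positive Phi & trace_preserving Phi].

Definition omegaXBR (X TB TR : finType) (p : X -> R)
  (psi : X -> qvec (TB * TR)%type) : op ((X * TB) * TR)%type :=
  fun xbr ybr =>
    if xbr.1.1 == ybr.1.1 then
      (p xbr.1.1)%:C%C * psi xbr.1.1 (xbr.1.2, xbr.2)
                     * (psi xbr.1.1 (ybr.1.2, ybr.2))^*
    else 0.

Definition nseqT (n : nat) (T : finType) := {ffun 'I_n -> T}.

Definition psi_n (n : nat) (X TB TR : finType) (psi : X -> qvec (TB * TR)%type)
  (xn : nseqT n X) : qvec (nseqT n TB * nseqT n TR)%type :=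
  fun br => \prod_(i < n) psi (xn i) (br.1 i, br.2 i).

(* the extended source omega^{X^n X'^n B^n R^n}, with its tensor factors
   ordered as (X^n (x) B^n) (x) (X'^n (x) R^n) *)
Definition omega_ext (n : nat) (X TB TR : finType) (p : X -> R)
  (psi : X -> qvec (TB * TR)%type)
  : op ((nseqT n X * nseqT n TB) * (nseqT n X * nseqT n TR))%type :=
  fun s t =>
    let: ((x, b), (x', r)) := s in
    let: ((y, b'), (y', r')) := t in
    if [&& x == x', x == y & x == y'] then
      (\prod_(i < n) p (x i))%:C%C * psi_n psi x (b, r) * (psi_n psi x (b', r'))^*
    else 0.

Definition code_output (n m : nat) (X TB TR : finType)
  (E : op (nseqT n TB) -> op 'I_m)
  (D : op (nseqT n X * 'I_m)%type -> op (nseqT n X * nseqT n TB)%type)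
  (w : op ((nseqT n X * nseqT n TB) * (nseqT n X * nseqT n TR))%type)
  : op ((nseqT n X * nseqT n TB) * (nseqT n X * nseqT n TR))%type :=
  lift_l (fun M => D (lift_r E M)) w.

End QuantumDefs.

Arguments omega_ext {R} n {X TB TR} p psi _ _.

(* Main.v *)
(* Bob sends the typical part of B^n through K Kraus operators into dimension m
   whose matrix entries are independent random signs.  For fixed x^n the vectors
   v_(k,i) = sqrt K A_k e_i, with k < K and e_i running over the s ~ 2^(n S(B|X))
   typical eigenvectors of psi_(x^n)^(B^n), are nearly orthonormal in C^m on average
   as soon as K s << m; the decoder, who knows x^n, orthonormalises them and maps
   v_(k,i) back to e_i, which recovers the entanglement with R^n.  The signs form
   nearly an isometry on the typical subspace of B^n, of dimension N ~ 2^(n S(B)), as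
   soon as N << K m.  Balancing both constraints, K ~ 2^(n (S(B) - S(B|X)) / 2) and
   m ~ 2^(n (S(B) + S(B|X)) / 2); concavity of the entropy gives K >= 1. *)

Require Import Defs.
From HB Require Import structures.
From mathcomp Require Import all_boot all_order all_algebra.
From mathcomp Require Import all_classical all_reals.
From mathcomp Require Import exp sequences topology normedtype.
From mathcomp.real_closed Require Import complex.
From mathcomp Require Import ring lra.
From mathcomp Require Import spectral sesquilinear.
From Stdlib Require ClassicalEpsilon.

Set Implicit Arguments.
Unset Strict Implicit.
Unset Printing Implicit Defensive.

Import Order.TTheory GRing.Theory Num.Theory numFieldNormedType.Exports.
Local Open Scope ring_scope.

(** * Vectors, orthonormal bases and the spectral theorem *)

Section LinearAlgebra.
Variable R : realType.
Local Notation C := R[i].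
Implicit Types T A B Z : finType.

(** The obstacle is that fidelity, operator roots and orthonormalisation are not polynomial in the
    random signs, while only second and fourth moments of signs are at hand. The fidelity is bounded
    below by the average entanglement fidelity, a sum of squared overlaps over Kraus pairs. Keeping
    only the pairs where decoder and encoder use the same k, Cauchy-Schwarz collapses them into the
    square of one number z, and z^2 >= 2 z - 1 makes the bound linear. The overlaps are in turn
    bounded below by [quality], a polynomial of degree four in the signs; some sign pattern does as
    well as the mean, for all x^n together because [quality] is already averaged over them. The
    encoder must be an exact contraction and uses a corrected family, whereas the decoder is
    designed for the uncorrected one; the correction does not depend on x^n, so it is weighed by the
    mean state, with a free parameter [eta]. With u = (n + 1)^(1/4), the choices delta = u^3 and eta
    = 1/u make n / delta^2, eta and e^(-delta) / eta vanish, while delta / n still tends to 0. *)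

Definition normsq (z : C) : R := complex.Re z ^+ 2 + complex.Im z ^+ 2.

Lemma normsqE (z : C) : (normsq z)%:C%C = z^* * z.
Proof.
by rewrite /normsq add_Re2_Im2 sqr_normc mulrC.
Qed.

Lemma normsq_ge0 z : 0 <= normsq z.
Proof. by rewrite addr_ge0 ?sqr_ge0. Qed.

Lemma normsq0 : normsq 0 = 0.
Proof. by rewrite /normsq /= expr0n addr0. Qed.

Lemma normsqR (x : R) : normsq x%:C%C = x ^+ 2.
Proof. by rewrite /normsq /= expr0n addr0. Qed.

Lemma normsqM x y : normsq (x * y) = normsq x * normsq y.
Proof. by case: x => a b; case: y => c d; rewrite /normsq /=; ring. Qed.

Lemma normsqJ x : normsq x^* = normsq x.
Proof. by case: x => a b; rewrite /normsq /= sqrrN. Qed.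

Lemma normsq_norm x : (normsq x)%:C%C = `|x| ^+ 2.
Proof. by rewrite normsqE sqr_normc mulrC. Qed.

Lemma Re_sum (I : Type) (r : seq I) (P : pred I) (F : I -> C) :
  complex.Re (\sum_(i <- r | P i) F i) = \sum_(i <- r | P i) complex.Re (F i).
Proof. by apply: (big_morph (@complex.Re R)) => //; case=> a b []. Qed.

Lemma ReD (x y : C) : complex.Re (x + y) = complex.Re x + complex.Re y.
Proof. by case: x y => a b []. Qed.
Lemma ReZ (a : R) (x : C) : complex.Re (a%:C%C * x) = a * complex.Re x.
Proof. by case: x => b c /=; rewrite mul0r subr0. Qed.
Lemma conjC_R (a : R) : (a%:C%C : C)^* = a%:C%C.
Proof. exact: conjc_real. Qed.

Lemma ReR (a : R) : complex.Re (a%:C%C : C) = a. Proof. by []. Qed.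

Definition dot T (u v : T -> C) : C := \sum_i (u i)^* * v i.
Definition nrm2 T (u : T -> C) : R := \sum_i normsq (u i).

Lemma nrm2E T (u : T -> C) : (nrm2 u)%:C%C = dot u u.
Proof. by rewrite rmorph_sum; apply: eq_bigr => i _; rewrite -normsqE. Qed.

Lemma nrm2_ge0 T (u : T -> C) : 0 <= nrm2 u.
Proof. by apply: sumr_ge0 => i _; exact: normsq_ge0. Qed.

Lemma dotC T (u v : T -> C) : (dot u v)^* = dot v u.
Proof.
by rewrite rmorph_sum; apply: eq_bigr => i _; rewrite rmorphM /= conjCK mulrC.
Qed.

Lemma eq_dot T (u u' v v' : T -> C) : u =1 u' -> v =1 v' -> dot u v = dot u' v'.
Proof. by move=> eu ev; apply: eq_bigr => i _; rewrite eu ev. Qed.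

Lemma eq_nrm2 T (u v : T -> C) : u =1 v -> nrm2 u = nrm2 v.
Proof. by move=> eu; apply: eq_bigr => i _; rewrite eu. Qed.

Lemma dot_sumr T A (u : T -> C) (c : A -> C) (y : A -> T -> C) :
  dot u (fun z => \sum_a c a * y a z) = \sum_a c a * dot u (y a).
Proof.
rewrite /dot; under eq_bigr do rewrite mulr_sumr.
rewrite exchange_big; apply: eq_bigr => a _; rewrite mulr_sumr.
by apply: eq_bigr => i _; rewrite mulrCA.
Qed.

Lemma dot_suml T A (u : T -> C) (c : A -> C) (y : A -> T -> C) :
  dot (fun z => \sum_a c a * y a z) u = \sum_a (c a)^* * dot (y a) u.
Proof.
rewrite -dotC dot_sumr rmorph_sum; apply: eq_bigr => a _.
by rewrite rmorphM /= dotC.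
Qed.

Lemma nrm2B T (u v : T -> C) :
  nrm2 (fun i => u i - v i) = nrm2 u - 2 * complex.Re (dot u v) + nrm2 v.
Proof.
rewrite /nrm2 /dot Re_sum mulr_sumr -sumrB -big_split /=.
apply: eq_bigr => i _; case: (u i) => a b; case: (v i) => c d.
by rewrite /normsq /=; ring.
Qed.

Lemma nrm2Z T (c : C) (u : T -> C) : nrm2 (fun i => c * u i) = normsq c * nrm2 u.
Proof. by rewrite /nrm2 mulr_sumr; apply: eq_bigr => i _; rewrite normsqM. Qed.

Lemma nrm2_eq0 T (u : T -> C) : nrm2 u = 0 -> forall i, u i = 0.
Proof.
move=> h i; have : normsq (u i) <= nrm2 u.
  by rewrite /nrm2 (bigD1 i) //= lerDl sumr_ge0 // => j _; exact: normsq_ge0.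
rewrite h => h2; have h3 : normsq (u i) = 0 by apply/eqP; rewrite eq_le h2 normsq_ge0.
move/eqP: h3; rewrite /normsq paddr_eq0 ?sqr_ge0 // !sqrf_eq0.
by case: (u i) => a b /= /andP[/eqP -> /eqP ->].
Qed.

(** The squared norm of eta u + v is nonnegative. The weight stays free so that a vector of norm at
    most 1 can be traded against a small error vector. *)
Lemma Re_dot_ge T (eta : R) (u v : T -> C) : 0 < eta ->
  - (eta * nrm2 u + nrm2 v / eta) / 2 <= complex.Re (dot u v).
Proof.
move=> e0; have := nrm2_ge0 (fun i => (- eta)%:C%C * u i - v i).
rewrite nrm2B nrm2Z normsqR.
have -> : dot (fun i => (- eta)%:C%C * u i) v = (- eta)%:C%C * dot u v.
  rewrite /dot mulr_sumr; apply: eq_bigr => i _.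
  by rewrite rmorphM /= conjC_R mulrA.
rewrite ReZ sqrrN => h.
rewrite -(ler_pM2l e0).
have -> : eta * (- (eta * nrm2 u + nrm2 v / eta) / 2) = - (eta ^+ 2 * nrm2 u + nrm2 v) / 2.
  by field; rewrite gt_eqF.
by lra.
Qed.

(** Cauchy-Schwarz against the constant vector: the sum of |F i - F j|^2 over all i, j is twice the
    difference of the two sides. *)
Lemma normsq_sum_le (I : finType) (F : I -> C) :
  normsq (\sum_i F i) <= #|I|%:R * \sum_i normsq (F i).
Proof.
pose m := #|I|%:R : R.
have h : 0 <= \sum_i \sum_j normsq (F i - F j).
  by apply: sumr_ge0 => i _; apply: sumr_ge0 => j _; exact: normsq_ge0.
have e : \sum_i \sum_j normsq (F i - F j) =
   2 * m * (\sum_i normsq (F i)) - 2 * normsq (\sum_i F i).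
  have e1 (i j : I) : normsq (F i - F j) =
     normsq (F i) + normsq (F j) - 2 * complex.Re ((F i)^* * F j).
    by case: (F i) => a b; case: (F j) => c d; rewrite /normsq /=; ring.
  under eq_bigr do under eq_bigr do rewrite e1.
  under eq_bigr do rewrite sumrB big_split /= sumr_const -mulr_sumr -Re_sum -mulr_sumr.
  rewrite sumrB big_split /= sumr_const -mulr_sumr -Re_sum -mulr_suml.
  rewrite -rmorph_sum -normsqE ReR sumrMnl.
  by rewrite -[_ *+ #|I|]mulr_natr -/m; ring.
by rewrite e in h; rewrite -/m; lra.
Qed.

(** The vectors share the index type of the coordinates; recording completeness next to
    orthonormality spares any dimension count. *)
Definition orthobasis T (e : T -> T -> C) : Prop :=
  (forall m m', dot (e m) (e m') = (m == m')%:R) /\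
  (forall a b, \sum_m e m a * (e m b)^* = (a == b)%:R).

Lemma sum_deltal T (F : T -> C) (a : T) : \sum_b (a == b)%:R * F b = F a.
Proof.
rewrite (bigD1 a) //= eqxx mul1r big1 ?addr0 // => b.
by rewrite eq_sym => /negbTE ->; rewrite mul0r.
Qed.

Lemma sum_deltar T (F : T -> C) (a : T) : \sum_b F b * (a == b)%:R = F a.
Proof. by under eq_bigr do rewrite mulrC; exact: sum_deltal. Qed.

Lemma orthobasis_expand T (e : T -> T -> C) (z : T -> C) : orthobasis e ->
  forall i, z i = \sum_m dot (e m) z * e m i.
Proof.
move=> [_ h] i; rewrite /dot; under eq_bigr do rewrite mulr_suml.
rewrite exchange_big /= -[LHS](sum_deltal z).
apply: eq_bigr => j _; rewrite -h mulr_suml; apply: eq_bigr => m _.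
by ring.
Qed.

(** The [y m] are orthogonal with squared lengths [g m], possibly zero. Combinations of vectors
    along eigenvectors of their Gram matrix have this form and cannot always be normalised. *)
Lemma dot_expand T A (c c' : A -> C) (y : A -> T -> C) (g : A -> C) :
  (forall m m', dot (y m) (y m') = (m == m')%:R * g m) ->
  dot (fun z => \sum_a c a * y a z) (fun z => \sum_a c' a * y a z) =
  \sum_a (c a)^* * c' a * g a.
Proof.
move=> h; rewrite dot_suml; apply: eq_bigr => a _; rewrite dot_sumr -mulrA.
congr (_ * _); under eq_bigr do rewrite h mulrCA.
exact: (sum_deltal (fun b => c' b * g a)).
Qed.

Lemma nrm2_expand T A (c : A -> C) (y : A -> T -> C) (g : A -> R) :
  (forall m m', dot (y m) (y m') = (m == m')%:R * (g m)%:C%C) ->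
  nrm2 (fun z => \sum_a c a * y a z) = \sum_a normsq (c a) * g a.
Proof.
move=> h; apply: complexI; rewrite nrm2E (dot_expand _ _ h) rmorph_sum.
by apply: eq_bigr => a _; rewrite -normsqE -rmorphM.
Qed.

Lemma nrm2_basis T (e : T -> T -> C) (c : T -> C) : orthobasis e ->
  nrm2 (fun z => \sum_a c a * e a z) = \sum_a normsq (c a).
Proof.
case=> h _; rewrite (@nrm2_expand _ _ _ _ (fun=> 1)).
  by apply: eq_bigr => a _; rewrite mulr1.
by move=> m m'; rewrite h mulr1.
Qed.

Lemma parseval T (e : T -> T -> C) (z : T -> C) : orthobasis e ->
  \sum_m normsq (dot (e m) z) = nrm2 z.
Proof.
by move=> he; rewrite -(nrm2_basis _ he); apply: eq_nrm2 => i; rewrite -orthobasis_expand.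
Qed.

Lemma orthobasis_nrm2 T (e : T -> T -> C) : orthobasis e -> forall m, nrm2 (e m) = 1.
Proof. by move=> [h _] m; apply: complexI; rewrite nrm2E h eqxx. Qed.

(** The residual of z after subtracting all <y m, z> y m has nonnegative squared norm, and
    [g m <= 1] absorbs its quadratic term into the cross term. *)
Lemma bessel T A (y : A -> T -> C) (g : A -> R) (z : T -> C) :
  (forall m m', dot (y m) (y m') = (m == m')%:R * (g m)%:C%C) ->
  (forall m, g m <= 1) -> \sum_m normsq (dot (y m) z) <= nrm2 z.
Proof.
move=> hy hg.
have := nrm2_ge0 (fun i => z i - \sum_a dot (y a) z * y a i).
rewrite nrm2B (nrm2_expand _ hy) dot_sumr.
have -> : complex.Re (\sum_a dot (y a) z * dot z (y a)) = \sum_m normsq (dot (y m) z).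
  rewrite Re_sum; apply: eq_bigr => m _.
  by rewrite -(dotC (y m)) mulrC -normsqE.
set S := \sum_m normsq _.
have : \sum_a normsq (dot (y a) z) * g a <= S.
  by apply: ler_sum => m _; rewrite ler_piMr ?normsq_ge0.
lra.
Qed.

(** [x], [y] stand for M a b and M b a, [x'], [y'] for their conjugates, [i] for the imaginary unit.
    The equations say that the quadratic form of M is real at e_a + i e_b and at e_a + e_b. *)
Lemma polarization_eq (F : numFieldType) (i x x' y y' u v : F) : i != 0 ->
  u + x' * - i + i * y' + i * v * - i = u + x * i + - i * y + - i * v * i ->
  u + x' + y' + v = u + x + y + v -> x = y'.
Proof.
move=> i0 h1 h2.
have e1 : i * (y' - x') = i * (x - y).
  apply: (addrI (u - i * v * i)).
  have -> : u - i * v * i + i * (y' - x') = u + x' * - i + i * y' + i * v * - i.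
    by ring.
  by rewrite h1; ring.
have e2 : x' + y' = x + y.
  apply: (addrI (u + v)).
  have -> : u + v + (x' + y') = u + x' + y' + v by ring.
  by rewrite h2; ring.
have {}e1 := mulfI i0 e1.
have h : 2 * x = 2 * y'.
  have -> : 2 * x = (x - y) + (x + y) by ring.
  by rewrite -e1 -e2; ring.
by apply: mulfI h; rewrite pnatr_eq0.
Qed.

Lemma psd_herm T (M : op R T) : psd M -> forall a b, M a b = (M b a)^*.
Proof.
move=> hM.
pose q (v : T -> C) := \sum_i \sum_j (v i)^* * M i j * v j.
have hq2 (a b : T) (c d : C) : q (fun i => c * (a == i)%:R + d * (b == i)%:R) =
   c^* * M a a * c + c^* * M a b * d + d^* * M b a * c + d^* * M b b * d.
  rewrite /q; under eq_bigr => i _.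
    rewrite (_ : \sum_j _ = c^* * ((a == i)%:R * (M i a * c + M i b * d)) + d^* * ((b == i)%:R * (M i a * c + M i b * d))).
      over.
    rewrite rmorphD !rmorphM /= !conjC_nat.
    under eq_bigr do rewrite mulrDr !mulrA.
    rewrite big_split /= !sum_deltar; ring.
  rewrite big_split /= -!mulr_sumr !(sum_deltal (fun i => M i a * c + M i b * d)).
  ring.
have hr v : (q v)^* = q v by have := hM v; rewrite -/(q v) => /ger0_real/CrealP.
move=> a b.
have e0 x : (M x x)^* = M x x.
  have := hr (fun i => 1 * (x == i)%:R + 0 * (x == i)%:R).
  by rewrite hq2 rmorph1 rmorph0 !(mul1r, mul0r, mulr1, mulr0, addr0).
have := hr (fun i => 1 * (a == i)%:R + 1 * (b == i)%:R).
have := hr (fun i => 1 * (a == i)%:R + 'i * (b == i)%:R).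
rewrite !hq2 !conjC1 !conjCi !(mul1r, mulr1) !(rmorphD, rmorphM, rmorphN) /= !e0.
rewrite !conjCi ?opprK; move=> h1 h2.
by exact: (polarization_eq (neq0Ci _) h1 h2).
Qed.

Lemma spectral_psd T (M : op R T) : psd M ->
  exists (e : T -> T -> C) (d : T -> R),
  [/\ orthobasis e, forall m, 0 <= d m &
      forall a b, M a b = \sum_m (d m)%:C%C * (e m a * (e m b)^*)].
Proof.
move=> hM; have hh := psd_herm hM.
pose A := mx_of_op M.
have hA : A \is hermitianmx _ false (@Num.conj_op C).
  apply/is_hermitianmxP; rewrite expr0 scale1r; apply/matrixP => i j.
  by rewrite !mxE hh.
have hN := hermitian_normalmx hA.
have hr := hermitian_spectral_diag_real hA.
move/orthomx_spectralP: hN.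
set P := spectralmx A; set D := spectral_diag A => eA.
have Pu : P \is unitarymx := spectral_unitarymx A.
rewrite invmx_unitary // in eA.
(* The spectral theorem gives A = P^-1 D P with [P] unitary, so the eigenvectors are the conjugated
   rows of [P]. *)
pose e m a : C := (P (enum_rank m) (enum_rank a))^*.
have sumE (F : 'I_#|T| -> C) : \sum_(t : T) F (enum_rank t) = \sum_i F i.
  rewrite [RHS](reindex (@enum_rank T)) //=.
  by apply: onW_bij; exact: enum_rank_bij.
have ob : orthobasis e.
  split=> a b.
    rewrite /dot /e.
    rewrite (sumE (fun i => (P (enum_rank a) i)^*^* * (P (enum_rank b) i)^*)).
    have /matrixP/(_ (enum_rank a) (enum_rank b)) := unitarymxP Pu.
    rewrite !mxE (inj_eq enum_rank_inj) => <-; apply: eq_bigr => i _.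
    by rewrite !mxE conjCK.
  rewrite /e (sumE (fun i => (P i (enum_rank a))^* * (P i (enum_rank b))^*^*)).
  have hP : (P ^t*)%sesqui *m P = 1%:M.
    by rewrite -(invmx_unitary Pu) mulVmx // unitarymx_unit.
  have /matrixP/(_ (enum_rank a) (enum_rank b)) := hP.
  rewrite !mxE (inj_eq enum_rank_inj) => <-; apply: eq_bigr => i _.
  by rewrite !mxE conjCK.
pose d m : R := complex.Re (D 0 (enum_rank m)).
have dE m : (d m)%:C%C = D 0 (enum_rank m).
  by rewrite RRe_real //; exact: (mxOverP hr).
have ME a b : M a b = \sum_m (d m)%:C%C * (e m a * (e m b)^*).
  have /matrixP/(_ (enum_rank a) (enum_rank b)) := eA.
  rewrite mxE !enum_rankK => ->; rewrite mxE -sumE; apply: eq_bigr => m _.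
  rewrite dE /e conjCK mul_mx_diag !mxE; ring.
exists e, d; split=> // m.
have := hM (e m).
have -> : \sum_i \sum_j (e m i)^* * M i j * e m j = (d m)%:C%C.
  transitivity (dot (e m) (fun i => \sum_k ((d k)%:C%C * dot (e k) (e m)) * e k i)).
    apply: eq_bigr => i _; rewrite mulr_sumr.
    under eq_bigr do rewrite ME !mulr_sumr mulr_suml.
    rewrite exchange_big /=; apply: eq_bigr => k _; rewrite mulr_sumr mulr_suml mulr_sumr.
    by apply: eq_bigr => j _; ring.
  rewrite dot_sumr (bigD1 m) //= big1 ?addr0.
    by rewrite !(ob.1) eqxx !mulr1.
  by move=> k km; rewrite !(ob.1) (negbTE km) mulr0 mul0r.
by rewrite ler0c.
Qed.

End LinearAlgebra.

(** * Turning a nearly orthonormal family into a contraction *)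

Section Operators.
Variable R : realType.
Local Notation C := R[i].
Implicit Types T A B Z : finType.

(* Normalising by f(g) = 2/(1+g) instead of 1/sqrt g keeps the family a
   contraction (AM-GM) and satisfies the same bounds 2g/(1+g) >= (3g-g^2)/2 and
   (1-f(g))^2 g <= (g-1)^2 without taking roots of the Gram matrix. *)
Lemma near_orthonormalization A Z (v : A -> Z -> C) :
  exists w : A -> Z -> C,
  [/\ forall z, \sum_a normsq (dot (w a) z) <= nrm2 z,
      forall a, (3 * nrm2 (v a) - \sum_b normsq (dot (v a) (v b))) / 2
                <= complex.Re (dot (w a) (v a)) &
      forall a, nrm2 (fun i => v a i - w a i)
                <= \sum_b normsq (dot (v a) (v b) - (a == b)%:R)].
Proof.
pose G : op R A := fun a b => dot (v a) (v b).
have Gpsd : psd G.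
  move=> x.
  have -> : \sum_i \sum_j (x i)^* * G i j * x j =
      dot (fun z => \sum_a x a * v a z) (fun z => \sum_a x a * v a z).
    rewrite dot_suml; apply: eq_bigr => i _; rewrite dot_sumr mulr_sumr.
    by apply: eq_bigr => j _; rewrite /G; ring.
  by rewrite -nrm2E ler0c nrm2_ge0.
have [e [g [[ob1 ob2] g0 GE]]] := spectral_psd Gpsd.
(* Along the eigenvectors of the Gram matrix the [v a] combine into orthogonal vectors of squared
   length [g m], so every bound below becomes a scalar inequality in [g m]. *)
pose y m z := \sum_a e m a * v a z.
have yy m m' : dot (y m) (y m') = (m == m')%:R * (g m)%:C%C.
  rewrite /y dot_suml.
  transitivity (\sum_a (e m a)^* * \sum_k ((g k)%:C%C * dot (e k) (e m')) * e k a).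
    apply: eq_bigr => a _; rewrite dot_sumr; congr (_ * _).
    under eq_bigr do rewrite -/(G _ _) GE mulr_sumr.
    rewrite exchange_big; apply: eq_bigr => k _.
    by rewrite mulr_sumr mulr_suml; apply: eq_bigr => b _; ring.
  transitivity (\sum_k ((g k)%:C%C * (k == m')%:R) * (m == k)%:R :> C).
    under eq_bigr do rewrite mulr_sumr.
    rewrite exchange_big; apply: eq_bigr => k _; rewrite -!ob1 [in RHS]mulr_sumr.
    by apply: eq_bigr => a _; ring.
  by rewrite sum_deltar mulrC.
have vE a z : v a z = \sum_m (e m a)^* * y m z.
  rewrite -[LHS](sum_deltal (fun b => v b z)) /y.
  under [RHS]eq_bigr do rewrite mulr_sumr.
  rewrite exchange_big; apply: eq_bigr => b _.
  by rewrite eq_sym -ob2 mulr_suml; apply: eq_bigr => m _; ring.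
pose f m : R := 2 / (1 + g m).
have f1 m : 0 < 1 + g m by rewrite ltr_pwDl.
pose w a z := \sum_m ((e m a)^* * (f m)%:C%C) * y m z.
have nvE a : nrm2 (v a) = \sum_m normsq (e m a) * g m.
  rewrite (eq_nrm2 (vE a)) (nrm2_expand _ yy).
  by apply: eq_bigr => m _; rewrite normsqJ.
(* Squared length of row [a] of h(G), for a function h of the Gram matrix; it is used for h(g) = g
   and h(g) = g - 1. *)
have GaE (h : R -> R) a :
    \sum_b normsq (\sum_m (h (g m))%:C%C * (e m a * (e m b)^*)) =
    \sum_m normsq (e m a) * h (g m) ^+ 2.
  transitivity (nrm2 (fun b => \sum_m ((h (g m))%:C%C * (e m a)^*) * e m b)).
    apply: eq_bigr => b _; rewrite -normsqJ rmorph_sum; congr normsq.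
    by apply: eq_bigr => m _; rewrite !rmorphM /= conjC_R conjCK mulrA.
  rewrite nrm2_basis //; apply: eq_bigr => m _.
  by rewrite normsqM normsqR normsqJ mulrC.
have GsE a : \sum_b normsq (dot (v a) (v b)) = \sum_m normsq (e m a) * g m ^+ 2.
  by rewrite -(GaE id); apply: eq_bigr => b _; rewrite -/(G a b) GE.
have GdE a : \sum_b normsq (dot (v a) (v b) - (a == b)%:R) =
             \sum_m normsq (e m a) * (g m - 1) ^+ 2.
  rewrite -(GaE (fun x => x - 1)); apply: eq_bigr => b _; rewrite -/(G a b) GE -ob2 -sumrB.
  by congr normsq; apply: eq_bigr => m _; rewrite rmorphB rmorph1; ring.
exists w; split.
- move=> z.
  have -> : \sum_a normsq (dot (w a) z) =
      \sum_m normsq (dot (fun t => (f m)%:C%C * y m t) z).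
    rewrite -[RHS](nrm2_basis _ (conj ob1 ob2)); apply: eq_bigr => a _.
    congr normsq; rewrite /w dot_suml; apply: eq_bigr => m _.
    have -> : dot (fun t => (f m)%:C%C * y m t) z = (f m)%:C%C * dot (y m) z.
      by rewrite /dot mulr_sumr; apply: eq_bigr => t _; rewrite rmorphM /= conjC_R mulrA.
    by rewrite rmorphM /= conjCK conjC_R; ring.
  (* The rescaled vectors have squared length 4 g / (1 + g)^2, at most 1. *)
  apply: (@bessel _ _ _ _ (fun m => f m ^+ 2 * g m)) => [m m'|m].
    transitivity ((f m)%:C%C * (f m')%:C%C * dot (y m) (y m')).
      by rewrite /dot mulr_sumr; apply: eq_bigr => t _; rewrite rmorphM /= conjC_R; ring.
    rewrite yy; case: eqP => [<-|_]; last by rewrite !mul0r mulr0.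
    by rewrite expr2 !rmorphM /=; ring.
  rewrite /f expr_div_n mulrAC ler_pdivrMr ?exprn_gt0 // mul1r.
  by have := sqr_ge0 (1 - g m); lra.
- move=> a; rewrite nvE GsE.
  have -> : dot (w a) (v a) = \sum_m ((e m a)^* * (f m)%:C%C)^* * (e m a)^* * (g m)%:C%C.
    by rewrite -(dot_expand _ _ yy); apply: eq_dot => // z; rewrite vE.
  rewrite Re_sum mulr_sumr -sumrB mulr_suml; apply: ler_sum => m _.
  have -> : ((e m a)^* * (f m)%:C%C)^* * (e m a)^* * (g m)%:C%C =
     (normsq (e m a) * (f m * g m))%:C%C.
    by move: (f m) => fm; rewrite !rmorphM /= normsqE conjCK conjC_R; ring.
  rewrite ReR.
  have -> : (3 * (normsq (e m a) * g m) - normsq (e m a) * g m ^+ 2) / 2 =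
     normsq (e m a) * ((3 * g m - g m ^+ 2) / 2) by field.
  apply: ler_wpM2l; first exact: normsq_ge0.
  rewrite /f mulrAC ler_pdivlMr //.
  have : 0 <= g m * (1 - g m) ^+ 2 by rewrite mulr_ge0 ?sqr_ge0.
  have -> : (3 * g m - g m ^+ 2) / 2 * (1 + g m) = 2 * g m - (g m * (1 - g m) ^+ 2) / 2.
    by field.
  by lra.
move=> a; rewrite GdE.
rewrite (@eq_nrm2 _ _ _ (fun i => \sum_m ((e m a)^* * (1 - f m)%:C%C) * y m i)); last first.
  move=> z; rewrite vE -sumrB; apply: eq_bigr => m _.
  by rewrite rmorphB rmorph1; ring.
rewrite (nrm2_expand _ yy); apply: ler_sum => m _.
rewrite normsqM normsqJ normsqR -mulrA; apply: ler_wpM2l; first exact: normsq_ge0.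
have -> : 1 - f m = (g m - 1) / (1 + g m) by rewrite /f; field; rewrite gt_eqF.
rewrite expr_div_n mulrAC ler_pdivrMr ?exprn_gt0 //.
apply: ler_wpM2l; first exact: sqr_ge0.
by have := g0 m; have := sqr_ge0 (g m); lra.
Qed.

(** Testing the inequality on [w a] itself gives |w a|^4 <= |w a|^2. *)
Lemma dot_le1 A Z (w : A -> Z -> C) :
  (forall z, \sum_a normsq (dot (w a) z) <= nrm2 z) -> forall a, nrm2 (w a) <= 1.
Proof.
move=> h a; have := h (w a); rewrite (bigD1 a) //=.
set S := \sum_(_ | _) _; have S0 : 0 <= S by apply: sumr_ge0 => ? _; exact: normsq_ge0.
rewrite -nrm2E normsqR => h2.
have h3 := nrm2_ge0 (w a).
have {}h2 : nrm2 (w a) ^+ 2 <= nrm2 (w a) by lra.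
by rewrite leNgt; apply/negP => h4; nra.
Qed.

End Operators.

(** * Square roots and fidelity *)

Section Fidelity.
Variable R : realType.
Local Notation C := R[i].
Implicit Types T A B Z : finType.

(** Working form of positive operators: products, square roots and traces then act on the
    eigenvalues [d] alone. *)
Definition specop T (e : T -> T -> C) (d : T -> R) : op R T :=
  fun a b => \sum_m (d m)%:C%C * (e m a * (e m b)^*).

Lemma specop_quad T (e : T -> T -> C) (d : T -> R) (u v : T -> C) :
  \sum_a \sum_b (u a)^* * specop e d a b * v b =
  \sum_m (d m)%:C%C * (dot u (e m) * dot (e m) v).
Proof.
under eq_bigr do under eq_bigr do rewrite /specop mulr_sumr mulr_suml.
under eq_bigr do rewrite exchange_big.
rewrite exchange_big /=; apply: eq_bigr => m _.
rewrite /dot mulr_suml mulr_sumr; apply: eq_bigr => a _.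
by rewrite !mulr_sumr; apply: eq_bigr => b _; ring.
Qed.

Lemma specop_psd T (e : T -> T -> C) (d : T -> R) :
  (forall m, 0 <= d m) -> psd (specop e d).
Proof.
move=> d0 v; rewrite specop_quad; apply: sumr_ge0 => m _.
by rewrite mulr_ge0 ?ler0c // -(dotC (e m)) -normsqE ler0c normsq_ge0.
Qed.

Lemma specop_mul T (e : T -> T -> C) (d d' : T -> R) : orthobasis e ->
  opmul (specop e d) (specop e d') = specop e (fun m => d m * d' m).
Proof.
move=> [ob _]; apply/funext => a; apply/funext => b; rewrite /opmul /specop.
transitivity (\sum_m \sum_k ((d m)%:C%C * (d' k)%:C%C * (e m a * (e k b)^*)) * (m == k)%:R : C).
  under eq_bigr do rewrite mulr_suml.
  rewrite exchange_big; apply: eq_bigr => m _ /=.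
  under eq_bigr do rewrite mulr_sumr.
  rewrite exchange_big; apply: eq_bigr => k _ /=.
  by rewrite -ob /dot mulr_sumr; apply: eq_bigr => c _; ring.
by apply: eq_bigr => m _; rewrite sum_deltar rmorphM.
Qed.

Lemma specop_tr T (e : T -> T -> C) (d : T -> R) : orthobasis e ->
  optr (specop e d) = (\sum_m d m)%:C%C.
Proof.
move=> [ob _]; rewrite /optr exchange_big rmorph_sum; apply: eq_bigr => m _.
rewrite -mulr_sumr -[RHS]mulr1 /=; congr (_ * _).
have -> : (1 : C) = (m == m)%:R by rewrite eqxx.
by rewrite -ob; apply: eq_bigr => a _; rewrite mulrC.
Qed.

Lemma psd_specop T (M : op R T) : psd M ->
  exists (e : T -> T -> C) (d : T -> R),
  [/\ orthobasis e, forall m, 0 <= d m & M = specop e d].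
Proof.
move=> /spectral_psd [e [d [ob d0 ME]]]; exists e, d; split=> //.
by apply/funext => a; apply/funext => b.
Qed.

Lemma psd_sqrt_exists T (M : op R T) : psd M -> exists Y, psd Y /\ opmul Y Y = M.
Proof.
move=> /psd_specop [e [d [ob d0 ->]]]; exists (specop e (fun m => Num.sqrt (d m))).
split; first by apply: specop_psd => m; exact: sqrtr_ge0.
rewrite specop_mul //; congr specop; apply/funext => m.
by rewrite -expr2 sqr_sqrtr.
Qed.

Lemma opsqrtP T (M : op R T) : psd M -> psd (opsqrt M) /\ opmul (opsqrt M) (opsqrt M) = M.
Proof.
by move=> /psd_sqrt_exists h; exact: (ClassicalEpsilon.epsilon_spec (inhabits (fun _ _ => 0)) _ h).
Qed.

(** [opsqrt] is a choice among positive roots, so uniqueness is what makes it computable.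
    Overlapping eigenvectors of two roots share the squared eigenvalue, hence the nonnegative
    eigenvalue itself. *)
Lemma psd_sqrt_uniq T (Y Z : op R T) : psd Y -> psd Z ->
  opmul Y Y = opmul Z Z -> Y = Z.
Proof.
move=> /psd_specop [e [d [ob d0 ->]]] /psd_specop [f [c [obf c0 ->]]].
rewrite !specop_mul // => h.
have dc m k : (d m)%:C%C * dot (e m) (f k) = (c k)%:C%C * dot (e m) (f k).
  have : \sum_a \sum_b (e m a)^* * specop e (fun m => d m * d m) a b * f k b =
     \sum_a \sum_b (e m a)^* * specop f (fun m => c m * c m) a b * f k b by rewrite h.
  rewrite !specop_quad.
  have -> : \sum_n (d n * d n)%:C%C * (dot (e m) (e n) * dot (e n) (f k)) =
            (d m * d m)%:C%C * dot (e m) (f k).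
    under eq_bigr do rewrite ob.1 mulrCA.
    exact: (sum_deltal (fun n => (d n * d n)%:C%C * dot (e n) (f k))).
  have -> : \sum_n (c n * c n)%:C%C * (dot (e m) (f n) * dot (f n) (f k)) =
            (c k * c k)%:C%C * dot (e m) (f k).
    under eq_bigr do rewrite obf.1 eq_sym mulrA.
    exact: (sum_deltar (fun n => (c n * c n)%:C%C * dot (e m) (f n))).
  have [->|w0] := eqVneq (dot (e m) (f k)) 0; first by rewrite !mulr0.
  move=> /(mulIf w0) /complexI /eqP; rewrite -!expr2 eqrXn2 //.
  by move=> /eqP ->.
apply/funext => a; apply/funext => b.
have fa k : f k a = \sum_m dot (e m) (f k) * e m a by exact: orthobasis_expand.
have eb m : (e m b)^* = \sum_k dot (e m) (f k) * (f k b)^*.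
  rewrite (orthobasis_expand (e m) obf b) rmorph_sum; apply: eq_bigr => k _.
  by rewrite rmorphM /= dotC.
rewrite /specop.
transitivity (\sum_m \sum_k (d m)%:C%C * dot (e m) (f k) * (e m a * (f k b)^*)).
  by apply: eq_bigr => m _; rewrite eb !mulr_sumr; apply: eq_bigr => k _; ring.
rewrite exchange_big; apply: eq_bigr => k _ /=.
rewrite fa mulr_suml mulr_sumr; apply: eq_bigr => m _.
by rewrite dc; ring.
Qed.

Lemma opsqrtE T (M Y : op R T) : psd Y -> opmul Y Y = M -> opsqrt M = Y.
Proof.
move=> hY YM.
have : exists Y, psd Y /\ opmul Y Y = M by exists Y.
move=> h; have [h1 h2] := ClassicalEpsilon.epsilon_spec (inhabits (fun _ _ => 0)) _ h.
by apply: psd_sqrt_uniq => //; rewrite YM; exact: h2.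
Qed.

Definition opapp A B (M : B -> A -> C) (v : A -> C) : B -> C := fun b => \sum_a M b a * v a.

(** In an eigenbasis e of |M| with eigenvalues d, the vector M e_m has length d_m, so each diagonal
    entry of M in that basis has real part at most d_m. *)
Lemma trnorm_ge T (M : op R T) : complex.Re (optr M) <= trnorm M.
Proof.
pose P := opmul (opadj M) M.
have PE v w : \sum_a \sum_b (v a)^* * P a b * w b = dot (opapp M v) (opapp M w).
  rewrite /dot /opapp /P /opmul /opadj.
  under [RHS]eq_bigr do rewrite rmorph_sum mulr_suml.
  rewrite [RHS]exchange_big; apply: eq_bigr => a _ /=.
  under eq_bigr do rewrite mulr_sumr mulr_suml.
  rewrite exchange_big; apply: eq_bigr => k _ /=; rewrite mulr_sumr.
  by apply: eq_bigr => b _; rewrite rmorphM /=; ring.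
have Ppsd : psd P by move=> v; rewrite PE -nrm2E ler0c nrm2_ge0.
have [Ypsd YY] := opsqrtP Ppsd.
rewrite /trnorm -/P; move: (opsqrt P) Ypsd YY => Y /psd_specop [e [d [ob d0 ->]]] {Y}.
rewrite specop_mul // specop_tr // ReR => YY.
have n2 m : nrm2 (opapp M (e m)) = d m ^+ 2.
  apply: complexI; rewrite nrm2E -PE -YY specop_quad (bigD1 m) //= big1 ?addr0.
    by rewrite !ob.1 eqxx !mulr1.
  by move=> k km; rewrite !ob.1 (negbTE km) mulr0 mulr0.
have -> : optr M = \sum_m dot (e m) (opapp M (e m)).
  rewrite /optr /dot exchange_big; apply: eq_bigr => a _ /=.
  rewrite -[LHS](sum_deltal (M a)) /opapp.
  under [RHS]eq_bigr do rewrite mulr_sumr.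
  rewrite exchange_big; apply: eq_bigr => b _ /=.
  by rewrite eq_sym -ob.2 mulr_suml; apply: eq_bigr => m _; ring.
rewrite Re_sum; apply: ler_sum => m _.
(* For d_m = 0 the vector M e_m vanishes; otherwise the expansion of |d_m e_m - M e_m|^2 >= 0 is
   divided by d_m. *)
have := d0 m; rewrite le_eqVlt => /orP[/eqP dm|dm].
  rewrite /dot big1 => [|i _]; first by rewrite -dm.
  by rewrite (nrm2_eq0 (u := opapp M (e m))) ?mulr0 // n2 -dm expr0n.
have := nrm2_ge0 (fun i => (d m)%:C%C * e m i - opapp M (e m) i).
rewrite nrm2B nrm2Z normsqR (orthobasis_nrm2 ob) n2.
have -> : dot (fun i => (d m)%:C%C * e m i) (opapp M (e m)) = (d m)%:C%C * dot (e m) (opapp M (e m)).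
  by rewrite /dot mulr_sumr; apply: eq_bigr => t _; rewrite rmorphM /= conjC_R mulrA.
rewrite ReZ => h; rewrite -(ler_pM2l dm) -expr2; lra.
Qed.

Definition expect T (v : T -> C) (M : op R T) : C := \sum_a \sum_b (v a)^* * M a b * v b.

(** The eigenvalues d of the root satisfy sum d^2 = 1, so d <= 1 and d^2 <= d. This removes the root
    of the channel output from the fidelity bound. *)
Lemma expect_sqrt_ge T (v : T -> C) (M : op R T) : psd M -> optr M = 1 ->
  complex.Re (expect v M) <= complex.Re (expect v (opsqrt M)).
Proof.
move=> Mpsd; have [Ypsd YM] := opsqrtP Mpsd.
move: (opsqrt M) Ypsd YM => Y /psd_specop [e [d [ob d0 ->]]] <- {Y}.
rewrite specop_mul // specop_tr // => /complexI d1.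
rewrite /expect !specop_quad !Re_sum; apply: ler_sum => m _; rewrite !ReZ.
have -> : complex.Re (dot v (e m) * dot (e m) v) = normsq (dot (e m) v).
  by rewrite -(dotC (e m)) -normsqE.
apply: ler_wpM2r; first exact: normsq_ge0.
have : d m * d m <= 1.
  by rewrite -d1 (bigD1 m) //= lerDl sumr_ge0 // => k _; rewrite mulr_ge0.
have := d0 m; nra.
Qed.

(** The tensor order and the three equality tests copy [omega_ext]: block diagonal in x, with X'
    forced to agree with X. *)
Definition blk (X A B : finType) (F : X -> op R (A * B)%type) :
    op R ((X * A) * (X * B))%type :=
  fun s t =>
    let: ((x, b), (x', r)) := s in
    let: ((y, b'), (y', r')) := t in
    if [&& x == x', x == y & x == y'] then F x (b, r) (b', r') else 0.

Lemma sum_pair A B (G : A * B -> C) : \sum_s G s = \sum_a \sum_b G (a, b).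
Proof. by rewrite pair_bigA; apply: eq_bigr => -[]. Qed.

Lemma sum_blk (X A B : finType) (G : (X * A) * (X * B) -> C) :
  (forall x a x' b, x != x' -> G ((x, a), (x', b)) = 0) ->
  \sum_s G s = \sum_x \sum_(t : A * B) G ((x, t.1), (x, t.2)).
Proof.
move=> h; rewrite sum_pair sum_pair; apply: eq_bigr => x _.
rewrite sum_pair; apply: eq_bigr => a _; rewrite sum_pair (bigD1 x) //=.
rewrite [X in _ + X]big1 ?addr0 //.
by move=> y yx; apply: big1 => b _; rewrite h // eq_sym.
Qed.

Lemma blk_mul (X A B : finType) (F G : X -> op R (A * B)%type) :
  opmul (blk F) (blk G) = blk (fun x => opmul (F x) (G x)).
Proof.
apply/funext => -[[x a] [x' b]]; apply/funext => -[[y a'] [y' b']].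
rewrite /opmul sum_blk => [|z c z' d zz]; last first.
  by rewrite /= (negbTE zz) /= mulr0.
rewrite (bigD1 x) //= [X in _ + X]big1 ?addr0 => [|z zx]; last first.
  by apply: big1 => t _; rewrite /= (eq_sym x z) (negbTE zx) !andbF mul0r.
rewrite /=; case: (x =P x') => [_|] /=; last by move=> _; apply: big1 => t _; rewrite mul0r.
rewrite eqxx /=; case: ifP => _; last by apply: big1 => t _; rewrite mulr0.
by apply: eq_bigr => -[].
Qed.

Lemma blk_tr (X A B : finType) (F : X -> op R (A * B)%type) :
  optr (blk F) = \sum_x optr (F x).
Proof.
rewrite /optr sum_blk => [|x a x' b xx]; last by rewrite /= (negbTE xx).
by apply: eq_bigr => x _; apply: eq_bigr => -[a b] _; rewrite /= !eqxx.
Qed.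

Lemma blk_psd (X A B : finType) (F : X -> op R (A * B)%type) :
  (forall x, psd (F x)) -> psd (blk F).
Proof.
move=> hF v.
rewrite (@sum_blk _ _ _ (fun i => \sum_j (v i)^* * blk F i j * v j)) => [|x a x' b xx]; last first.
  by apply: big1 => -[[y a'] [y' b']] _; rewrite /= (negbTE xx) mulr0 mul0r.
apply: sumr_ge0 => x _.
have := hF x (fun t => v ((x, t.1), (x, t.2))); congr (_ <= _).
apply: eq_bigr => -[a b] _.
rewrite (@sum_blk _ _ _ (fun j => (v (x, a, (x, b)))^* * blk F (x, a, (x, b)) j * v j)) => [|y c y' d yy]; last first.
  case: (x =P y) yy => [->|xy] yy; first by rewrite /= (negbTE yy) !andbF mulr0 mul0r.
  by rewrite /= (introF eqP xy) !andbF mulr0 mul0r.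
rewrite (bigD1 x) //= [X in _ + X]big1 ?addr0 => [|y yx]; last first.
  by apply: big1 => t _; rewrite (eq_sym x y) (negbTE yx) !andbF mulr0 mul0r.
by apply: eq_bigr => -[c d] _ /=; rewrite !eqxx.
Qed.

Lemma psdZ T (a : R) (M : op R T) : 0 <= a -> psd M -> psd (fun i j => a%:C%C * M i j).
Proof.
move=> a0 hM v; have := mulr_ge0 (_ : 0 <= a%:C%C) (hM v); rewrite ler0c => /(_ a0).
congr (_ <= _); rewrite mulr_sumr; apply: eq_bigr => i _; rewrite mulr_sumr.
by apply: eq_bigr => j _; ring.
Qed.

Definition ketbra T (v : T -> C) : op R T := fun i j => v i * (v j)^*.

Lemma ketbra_quad T (v u w : T -> C) :
  \sum_i \sum_j (u i)^* * ketbra v i j * w j = dot u v * dot v w.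
Proof.
rewrite /dot mulr_suml; apply: eq_bigr => i _; rewrite mulr_sumr.
by apply: eq_bigr => j _; rewrite /ketbra; ring.
Qed.

Lemma ketbra_psd T (v : T -> C) : psd (ketbra v).
Proof.
by move=> u; rewrite ketbra_quad -(dotC v) -normsqE ler0c normsq_ge0.
Qed.

Lemma ketbra_mull T (v : T -> C) (M : op R T) : optr (opmul (ketbra v) M) = expect v M.
Proof.
rewrite /optr /opmul /expect /ketbra exchange_big; apply: eq_bigr => a _ /=.
by apply: eq_bigr => b _; ring.
Qed.

(* Tr (sqrt rho sqrt sigma) bounds the fidelity from below, and sigma_x <= sqrt sigma_x. *)
Lemma fidelity_blk (X A B : finType) (p : X -> R) (psi : X -> A * B -> C)
    (sigma : X -> op R (A * B)%type) :
  (forall x, 0 <= p x) -> (forall x, nrm2 (psi x) = 1) ->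
  (forall x, psd (sigma x)) -> (forall x, optr (sigma x) = 1) ->
  \sum_x p x * complex.Re (expect (psi x) (sigma x)) <=
  fidelity (blk (fun x i j => (p x)%:C%C * ketbra (psi x) i j))
           (blk (fun x i j => (p x)%:C%C * sigma x i j)).
Proof.
move=> p0 psi1 spsd str; rewrite /fidelity.
pose sp x := Num.sqrt (p x).
have sp0 x : 0 <= sp x by exact: sqrtr_ge0.
have spE x : (sp x)%:C%C * (sp x)%:C%C = (p x)%:C%C :> C.
  by rewrite -rmorphM -expr2 sqr_sqrtr.
have sqrt1 : opsqrt (blk (fun x i j => (p x)%:C%C * ketbra (psi x) i j)) =
    blk (fun x i j => (sp x)%:C%C * ketbra (psi x) i j).
  apply: opsqrtE; first by apply: blk_psd => x; apply: psdZ => //; exact: ketbra_psd.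
  rewrite blk_mul; congr blk; apply/funext => x; apply/funext => i; apply/funext => j.
  rewrite /opmul /ketbra -spE.
  transitivity ((sp x)%:C%C * (sp x)%:C%C * (psi x i * (psi x j)^*) * dot (psi x) (psi x)).
    by rewrite /dot mulr_sumr; apply: eq_bigr => k _; ring.
  by rewrite -nrm2E psi1 mulr1.
have sqrt2 : opsqrt (blk (fun x i j => (p x)%:C%C * sigma x i j)) =
    blk (fun x i j => (sp x)%:C%C * opsqrt (sigma x) i j).
  apply: opsqrtE; first by apply: blk_psd => x; apply: psdZ => //; case: (opsqrtP (spsd x)).
  rewrite blk_mul; congr blk; apply/funext => x; apply/funext => i; apply/funext => j.
  have [_ /(congr1 (fun M : op R _ => M i j)) <-] := opsqrtP (spsd x).
  rewrite /opmul -spE mulr_sumr.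
  by apply: eq_bigr => k _; ring.
apply: le_trans (trnorm_ge _).
rewrite sqrt1 sqrt2 blk_mul blk_tr Re_sum; apply: ler_sum => x _.
have -> : optr (opmul (fun i j => (sp x)%:C%C * ketbra (psi x) i j)
    (fun i j => (sp x)%:C%C * opsqrt (sigma x) i j)) =
   (p x)%:C%C * expect (psi x) (opsqrt (sigma x)).
  rewrite -ketbra_mull /optr mulr_sumr; apply: eq_bigr => i _; rewrite /opmul mulr_sumr.
  by apply: eq_bigr => j _; rewrite -spE; ring.
rewrite ReZ; apply: ler_wpM2l => //; exact: expect_sqrt_ge.
Qed.

End Fidelity.

(** * Quantum channels *)

Section Channels.
Variable R : realType.
Local Notation C := R[i].
Implicit Types T A B Z : finType.

Definition kraus (J A B : finType) (L : J -> B -> A -> C) (M : op R A) : op R B :=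
  fun b b' => \sum_j \sum_a \sum_a' L j b a * M a a' * (L j b' a')^*.

Lemma kraus_linear (J A B : finType) (L : J -> B -> A -> C) : linear_map (kraus L).
Proof.
move=> c M N; apply/funext => b; apply/funext => b'; rewrite /kraus.
rewrite mulr_sumr -big_split; apply: eq_bigr => j _ /=.
rewrite mulr_sumr -big_split; apply: eq_bigr => a _ /=.
rewrite mulr_sumr -big_split; apply: eq_bigr => a' _ /=.
by ring.
Qed.

Lemma krausZ (J A B : finType) (L : J -> B -> A -> C) (c : C) M b b' :
  kraus L (fun i j => c * M i j) b b' = c * kraus L M b b'.
Proof.
rewrite /kraus mulr_sumr; apply: eq_bigr => j _.
rewrite mulr_sumr; apply: eq_bigr => a _.
rewrite mulr_sumr; apply: eq_bigr => a' _.
by ring.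
Qed.

Lemma kraus0 (J A B : finType) (L : J -> B -> A -> C) b b' :
  kraus L (fun _ _ => 0) b b' = 0.
Proof.
by rewrite /kraus big1 // => j _; rewrite big1 // => a _; rewrite big1 // => a' _; rewrite mulr0 mul0r.
Qed.

Lemma sum_pair2 A B (E : finType) (G : A * E -> B * E -> C) :
  \sum_s \sum_t G s t = \sum_e \sum_e' \sum_a \sum_b G (a, e) (b, e').
Proof.
rewrite sum_pair exchange_big; apply: eq_bigr => e _ /=.
under eq_bigr do rewrite sum_pair exchange_big /=.
by rewrite exchange_big.
Qed.

Lemma kraus_quad (J A B : finType) (L : J -> B -> A -> C) (N : op R A) (v w : B -> C) :
  \sum_b \sum_b' (v b)^* * kraus L N b b' * w b' =
  \sum_j \sum_a \sum_a' (\sum_b (L j b a)^* * v b)^* * N a a' * (\sum_b (L j b a')^* * w b).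
Proof.
have e1 b b' : (v b)^* * kraus L N b b' * w b' =
   \sum_j \sum_a \sum_a' (v b)^* * L j b a * N a a' * (L j b' a')^* * w b'.
  rewrite /kraus mulr_sumr mulr_suml; apply: eq_bigr => j _.
  rewrite mulr_sumr mulr_suml; apply: eq_bigr => a _.
  rewrite mulr_sumr mulr_suml; apply: eq_bigr => a' _.
  by ring.
under eq_bigr do under eq_bigr do rewrite e1.
under eq_bigr do rewrite exchange_big /=.
rewrite exchange_big; apply: eq_bigr => j _ /=.
rewrite pair_bigA; under eq_bigr do rewrite pair_bigA.
rewrite exchange_big [RHS]pair_bigA /=; apply: eq_bigr => -[a a'] _ /=.
rewrite -(pair_bigA _ (fun b b' => (v b)^* * L j b a * N a a' * (L j b' a')^* * w b')) /=.
rewrite rmorph_sum !mulr_suml; apply: eq_bigr => b _; rewrite mulr_sumr.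
by apply: eq_bigr => b' _; rewrite rmorphM /= conjCK; ring.
Qed.

(** The adjoint Kraus operators are moved onto the test vectors, which leaves a sum of quadratic
    forms of [M]; complete positivity follows for any ancilla. *)
Lemma kraus_lift_quad (J A B E : finType) (L : J -> B -> A -> C) (M : op R (A * E)%type)
    (v w : B * E -> C) :
  \sum_s \sum_t (v s)^* * lift_l (kraus L) M s t * w t =
  \sum_j \sum_s \sum_t (\sum_b (L j b s.1)^* * v (b, s.2))^* * M s t *
                       (\sum_b (L j b t.1)^* * w (b, t.2)).
Proof.
rewrite sum_pair2; under [RHS]eq_bigr do rewrite sum_pair2 /=.
rewrite [RHS]exchange_big; apply: eq_bigr => e _ /=.
rewrite [RHS]exchange_big; apply: eq_bigr => e' _ /=.
exact: (kraus_quad L (fun a a' => M (a, e) (a', e')) (fun b => v (b, e)) (fun b => w (b, e'))).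
Qed.

Lemma kraus_cp (J A B E : finType) (L : J -> B -> A -> C) (M : op R (A * E)%type) :
  psd M -> psd (lift_l (kraus L) M).
Proof.
move=> hM v; rewrite kraus_lift_quad; apply: sumr_ge0 => j _.
exact: (hM (fun s => \sum_b (L j b s.1)^* * v (b, s.2))).
Qed.

Lemma kraus_tp (J A B : finType) (L : J -> B -> A -> C) :
  (forall a a', \sum_j \sum_b (L j b a')^* * L j b a = (a' == a)%:R) ->
  trace_preserving (kraus L).
Proof.
move=> h M; rewrite /optr /kraus.
transitivity (\sum_a \sum_a' (a' == a)%:R * M a a').
  under [RHS]eq_bigr do under eq_bigr do rewrite -h.
  rewrite exchange_big /=.
  under eq_bigr do rewrite exchange_big /=.
  rewrite exchange_big; apply: eq_bigr => a _ /=.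
  under eq_bigr do rewrite exchange_big /=.
  rewrite exchange_big; apply: eq_bigr => a' _ /=.
  rewrite mulr_suml; apply: eq_bigr => j _; rewrite mulr_suml.
  by apply: eq_bigr => b _; ring.
apply: eq_bigr => a _; under eq_bigr do rewrite eq_sym.
exact: (sum_deltal (M a)).
Qed.

Lemma kraus_CPTP (J A B : finType) (L : J -> B -> A -> C) :
  (forall a a', \sum_j \sum_b (L j b a')^* * L j b a = (a' == a)%:R) ->
  CPTP (kraus L).
Proof.
move=> h; split; [exact: kraus_linear | | exact: kraus_tp].
by move=> k M; exact: kraus_cp.
Qed.

(** The deficit 1 - sum_j L_j^dagger L_j is positive. Each of its eigenvectors e_m, with eigenvalue
    d_m, contributes an extra Kraus operator sqrt(d_m) |b0><e_m|, which dumps the missing weight in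
    the fixed state [b0]. *)
Lemma kraus_completion (J A B : finType) (b0 : B) (L : J -> B -> A -> C) :
  (forall z, \sum_j nrm2 (opapp (L j) z) <= nrm2 z) ->
  exists L' : (J + A)%type -> B -> A -> C,
    (forall j, L' (inl j) = L j) /\
    (forall a a', \sum_j \sum_b (L' j b a')^* * L' j b a = (a' == a)%:R).
Proof.
move=> hL.
pose P : op R A := fun a' a => (a' == a)%:R - \sum_j \sum_b (L j b a')^* * L j b a.
have Ppsd : psd P.
  move=> v.
  have -> : \sum_i \sum_j (v i)^* * P i j * v j =
     (nrm2 v - \sum_j nrm2 (opapp (L j) v))%:C%C.
    rewrite rmorphB /= nrm2E [X in _ - X]rmorph_sum /=.
    under [X in _ - X]eq_bigr do rewrite nrm2E.
    have -> : \sum_i dot (opapp (L i) v) (opapp (L i) v) =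
       \sum_a \sum_a' (v a)^* * (\sum_j \sum_b (L j b a)^* * L j b a') * v a'.
      under [RHS]eq_bigr do under eq_bigr do rewrite mulr_sumr mulr_suml.
      under [RHS]eq_bigr do rewrite exchange_big /=.
      rewrite [RHS]exchange_big /=; apply: eq_bigr => j _.
      rewrite /dot /opapp; under [LHS]eq_bigr do rewrite rmorph_sum mulr_suml.
      rewrite exchange_big /=; apply: eq_bigr => a _.
      under eq_bigr do rewrite mulr_sumr.
      rewrite exchange_big; apply: eq_bigr => a' _ /=.
      rewrite mulr_sumr mulr_suml; apply: eq_bigr => b _.
      by rewrite rmorphM /=; ring.
    rewrite /dot -sumrB; apply: eq_bigr => a _.
    rewrite -[X in _ = _ * X - _](sum_deltal v) mulr_sumr -sumrB; apply: eq_bigr => a' _.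
    by rewrite /P; ring.
  by rewrite ler0c subr_ge0.
have [e [d [ob d0 PE]]] := spectral_psd Ppsd.
exists (fun j b a => match j with inl j => L j b a
  | inr m => (b0 == b)%:R * ((Num.sqrt (d m))%:C%C * (e m a)^*) end).
split=> // a a'.
rewrite big_sumType /=.
have -> : \sum_m \sum_b ((b0 == b)%:R * ((Num.sqrt (d m))%:C%C * (e m a')^*))^* *
    ((b0 == b)%:R * ((Num.sqrt (d m))%:C%C * (e m a)^*)) = P a' a.
  rewrite PE; apply: eq_bigr => m _.
  under eq_bigr do rewrite rmorphM /= conjC_nat -mulrA.
  rewrite (sum_deltal (fun b => ((Num.sqrt (d m))%:C%C * (e m a')^*)^* *
    ((b0 == b)%:R * ((Num.sqrt (d m))%:C%C * (e m a)^*)))) eqxx mul1r.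
  rewrite rmorphM /= conjCK conjC_R.
  rewrite -[X in X%:C%C * (e m a' * _)](sqr_sqrtr (d0 m)) expr2 rmorphM /=.
  by ring.
by rewrite /P addrC subrK.
Qed.

(** A decoder that measures x, keeps it and applies [D x]: coherences between different x are
    erased. *)
Definition controlled (X A B : finType) (D : X -> op R A -> op R B)
    (M : op R (X * A)%type) : op R (X * B)%type :=
  fun s t => if s.1 == t.1 then D s.1 (fun a a' => M (s.1, a) (s.1, a')) s.2 t.2 else 0.

Lemma controlled_CPTP (X A B : finType) (D : X -> op R A -> op R B) :
  (forall x, CPTP (D x)) -> CPTP (controlled D).
Proof.
move=> hD; split.
- move=> c M N; apply/funext => -[x b]; apply/funext => -[y b'].
  rewrite /controlled /=; case: eqP => _; last by rewrite mulr0 addr0.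
  by case: (hD x) => -> .
- move=> k M hM v.
  (* Only the diagonal blocks of [M] matter, and each is a compression of a positive operator. *)
  pose Mx x : op R (A * 'I_k)%type := fun s t => M ((x, s.1), s.2) ((x, t.1), t.2).
  have Mxpsd x : psd (Mx x).
    move=> u; have := hM (fun s => (x == s.1.1)%:R * u (s.1.2, s.2)).
    congr (_ <= _); rewrite sum_pair2 [RHS]sum_pair2.
    apply: eq_bigr => e _; apply: eq_bigr => e' _.
    under eq_bigr do rewrite sum_pair.
    rewrite sum_pair (bigD1 x) //= [X in _ + X]big1 ?addr0 => [|y yx]; last first.
      apply: big1 => a _; rewrite big1 // => z _; rewrite big1 // => c _.
      by rewrite /= eq_sym (negbTE yx) mul0r rmorph0 !mul0r.
    apply: eq_bigr => a _.
    rewrite (bigD1 x) //= [X in _ + X]big1 ?addr0 => [|y yx]; last first.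
      by apply: big1 => c _; rewrite eq_sym (negbTE yx) mul0r !mulr0.
    by apply: eq_bigr => c _; rewrite eqxx !mul1r.
  suff -> : \sum_s \sum_t (v s)^* * lift_l (controlled D) M s t * v t =
     \sum_x \sum_s \sum_t (v ((x, s.1), s.2))^* * lift_l (D x) (Mx x) s t * v ((x, t.1), t.2).
    apply: sumr_ge0 => x _; have [_ h _] := hD x.
    exact: (h k _ (Mxpsd x) (fun s => v ((x, s.1), s.2))).
  rewrite sum_pair2; under [RHS]eq_bigr do rewrite sum_pair2.
  rewrite [RHS]exchange_big; apply: eq_bigr => e _ /=.
  rewrite [RHS]exchange_big; apply: eq_bigr => e' _ /=.
  rewrite sum_pair; apply: eq_bigr => x _; apply: eq_bigr => b _.
  rewrite sum_pair (bigD1 x) //= [X in _ + X]big1 ?addr0 => [|y yx]; last first.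
    by apply: big1 => b' _; rewrite /lift_l /controlled /= eq_sym (negbTE yx) mulr0 mul0r.
  by apply: eq_bigr => b' _; rewrite /lift_l /controlled /= eqxx.
- move=> M; rewrite /optr sum_pair [RHS]sum_pair; apply: eq_bigr => x _.
  have [_ _ h] := hD x; rewrite -[RHS](h (fun a a' => M (x, a) (x, a'))).
  by apply: eq_bigr => b _; rewrite /controlled /= eqxx.
Qed.

Definition kcomp (J J' A B Z : finType) (L : J -> Z -> B -> C) (L' : J' -> B -> A -> C) :
    (J * J')%type -> Z -> A -> C := fun j z a => \sum_b L j.1 z b * L' j.2 b a.

Lemma kraus_comp (J J' A B Z : finType) (L : J -> Z -> B -> C) (L' : J' -> B -> A -> C)
    (M : op R A) : kraus L (kraus L' M) = kraus (kcomp L L') M.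
Proof.
apply/funext => z; apply/funext => z'; rewrite /kraus sum_pair; apply: eq_bigr => j _.
transitivity (\sum_b \sum_b' ((L j z b)^*)^* * kraus L' M b b' * (L j z' b')^*).
  by apply: eq_bigr => b _; apply: eq_bigr => b' _; rewrite conjCK.
rewrite (kraus_quad _ _ (fun b => (L j z b)^*) (fun b => (L j z' b)^*)).
apply: eq_bigr => j' _; apply: eq_bigr => a _; apply: eq_bigr => a' _ /=.
congr (_ * _ * _); rewrite /kcomp !rmorph_sum /=.
  by apply: eq_bigr => b _; rewrite rmorphM /= !conjCK mulrC.
by apply: eq_bigr => b _; rewrite rmorphM /= mulrC.
Qed.

(* <psi| (L (x) 1) |psi> *)
Definition overlap (B E : finType) (psi : B * E -> C) (L : B -> B -> C) : C :=
  \sum_a \sum_b L b a * (\sum_r psi (a, r) * (psi (b, r))^*).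

(** Entanglement fidelity in Kraus form: with rho the reduced state of [psi], operator j contributes
    |Tr (L_j rho)|^2. *)
Lemma expect_kraus (J B E : finType) (psi : B * E -> C) (L : J -> B -> B -> C) :
  complex.Re (expect psi (lift_l (kraus L) (ketbra psi))) = \sum_j normsq (overlap psi (L j)).
Proof.
rewrite /expect kraus_lift_quad Re_sum; apply: eq_bigr => j _.
rewrite ketbra_quad -[dot psi _]dotC mulrC -normsqE ReR; congr normsq.
rewrite /overlap /dot sum_pair.
apply: eq_bigr => a _.
under [LHS]eq_bigr do rewrite rmorph_sum mulr_suml.
rewrite exchange_big; apply: eq_bigr => b _ /=; rewrite mulr_sumr.
by apply: eq_bigr => r _; rewrite rmorphM /= conjCK; ring.
Qed.

Lemma lift_ketbra_psd (J B E : finType) (L : J -> B -> B -> C) (psi : B * E -> C) :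
  psd (lift_l (kraus L) (ketbra psi)).
Proof. by apply: kraus_cp; exact: ketbra_psd. Qed.

Lemma lift_tr (A B E : finType) (Phi : op R A -> op R B) (M : op R (A * E)%type) :
  trace_preserving Phi -> optr (lift_l Phi M) = optr M.
Proof.
move=> h; rewrite /optr sum_pair exchange_big /= [RHS]sum_pair [RHS]exchange_big /=.
by apply: eq_bigr => e _; exact: (h (fun a a' => M (a, e) (a', e))).
Qed.

Lemma ketbra_tr T (v : T -> C) : optr (ketbra v) = (nrm2 v)%:C%C.
Proof. by rewrite nrm2E; apply: eq_bigr => i _; rewrite /ketbra mulrC. Qed.

(** The source is classical in x, so the measurement inside [controlled] does no damage, and the
    output keeps the block form that [fidelity_blk] handles. *)
Lemma controlled_output (J J' X B E Z : finType) (L : X -> J -> B -> Z -> C)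
    (L' : J' -> Z -> B -> C) (p : X -> R) (psi : X -> B * E -> C) :
  lift_l (fun M => controlled (fun x => kraus (L x)) (lift_r (kraus L') M))
    (blk (fun x i j => (p x)%:C%C * ketbra (psi x) i j)) =
  blk (fun x i j => (p x)%:C%C *
                    lift_l (kraus (kcomp (L x) L')) (ketbra (psi x)) i j).
Proof.
apply/funext => -[[x b] [x' r]]; apply/funext => -[[y b'] [y' r']].
rewrite /lift_l /controlled /lift_r /=.
case: (x =P y) => [_|_] /=; last by rewrite andbF.
have [/andP[/eqP <- /eqP <-]|h] := boolP ((x == x') && (x == y')).
  rewrite !eqxx /= -kraus_comp -krausZ.
  congr (kraus (L x) _ b b'); apply/funext => z; apply/funext => z'.
  by rewrite -krausZ; congr kraus; apply/funext => a; apply/funext => a'; rewrite eqxx.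
rewrite /= -[RHS](kraus0 (L x) b b').
congr (kraus (L x) _ b b'); apply/funext => z; apply/funext => z'.
rewrite -[RHS](kraus0 L' z z'); congr kraus; apply/funext => a; apply/funext => a'.
by rewrite eqxx /= (negbTE h).
Qed.

End Channels.

(** * Quadratic forms in random signs *)

Section Rademacher.
Variable R : realType.
Local Notation C := R[i].
Variable W : finType.
Implicit Types (g : {ffun W -> bool}) (F : {ffun W -> bool} -> R).

Definition sgn g (a : W) : R := (-1) ^+ g a.

Definition avg F : R := (\sum_g F g) / #|{ffun W -> bool}|%:R.

Lemma card_signs_gt0 : 0 < #|{ffun W -> bool}|%:R :> R.
Proof. by rewrite ltr0n; apply/card_gt0P; exists [ffun=> true]. Qed.

Lemma avg_cst c : avg (fun=> c) = c.
Proof. by rewrite /avg sumr_const -[_ *+ _]mulr_natr mulfK // gt_eqF ?card_signs_gt0. Qed.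

Lemma avgD F F' : avg (fun g => F g + F' g) = avg F + avg F'.
Proof. by rewrite /avg big_split mulrDl. Qed.

Lemma avgZ c F : avg (fun g => c * F g) = c * avg F.
Proof. by rewrite /avg -mulr_sumr mulrA. Qed.

Lemma avg_sum (I : finType) (P : pred I) (F : I -> {ffun W -> bool} -> R) :
  avg (fun g => \sum_(i | P i) F i g) = \sum_(i | P i) avg (F i).
Proof. by rewrite /avg exchange_big mulr_suml. Qed.

Lemma avg_le F F' : (forall g, F g <= F' g) -> avg F <= avg F'.
Proof.
by move=> h; rewrite ler_pM2r ?invr_gt0 ?card_signs_gt0 //; apply: ler_sum.
Qed.

Lemma eq_avg F F' : F =1 F' -> avg F = avg F'.
Proof. by move=> h; congr (_ / _); apply: eq_bigr. Qed.

(** Probabilistic method: there is at least one sign pattern, so a strict bound on all values would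
    pass to the mean. *)
Lemma avg_exists F c : c <= avg F -> exists g, c <= F g.
Proof.
move=> h; apply: contrapT => /forallNP hn; move: h.
rewrite -(avg_cst c) leNgt => /negP; apply.
rewrite /avg ltr_pM2r ?invr_gt0 ?card_signs_gt0 //.
apply: ltr_sum => [|g _]; first by apply/hasP; exists [ffun=> true]; rewrite ?mem_index_enum.
by rewrite ltNge; apply/negP; exact: hn.
Qed.

Definition flip (a : W) g : {ffun W -> bool} := [ffun x => g x (+) (x == a)].

Lemma flipK a : involutive (flip a).
Proof. by move=> g; apply/ffunP => x; rewrite !ffunE addbK. Qed.

Lemma sgn_flip a g b : sgn (flip a g) b = if b == a then - sgn g b else sgn g b.
Proof. by rewrite /sgn ffunE signr_addb; case: eqP; rewrite ?mulr1 ?mulrN1. Qed.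

(** Flipping one sign permutes the sign patterns, so the average equals its own negative. *)
Lemma avg_odd a F : (forall g, F (flip a g) = - F g) -> avg F = 0.
Proof.
move=> h; have e : avg F = - avg F.
  rewrite {1}/avg (reindex_inj (inv_inj (flipK a))) /=.
  by under eq_bigr do rewrite h; rewrite sumrN mulNr.
by move/eqP: e; rewrite -subr_eq0 opprK -mulr2n mulrn_eq0 => /eqP.
Qed.

Lemma sgn_sq g a : sgn g a * sgn g a = 1.
Proof. by rewrite /sgn -signr_addb addbb. Qed.

Lemma avg_sgn2 a b : avg (fun g => sgn g a * sgn g b) = (a == b)%:R.
Proof.
have [->|ab] := eqVneq a b; first by rewrite (eq_avg (sgn_sq^~ b)) avg_cst.
apply: (avg_odd (a := a)) => g.
by rewrite !sgn_flip eqxx (eq_sym b) (negbTE ab) mulNr.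
Qed.

(** Only {c, d} = {a, b} can survive: in every other case some index occurs an odd number of times,
    and flipping its sign reverses the product. *)
Lemma avg_sgn4 a b c d : a != b -> c != d ->
  `|avg (fun g => (sgn g a * sgn g b) * (sgn g c * sgn g d))| <=
  ((c, d) == (a, b))%:R + ((c, d) == (b, a))%:R.
Proof.
move=> ab cd; set F := fun g => _.
have le1 : `|avg F| <= 1.
  have h g : `|F g| = 1 by rewrite /F /sgn !normrM !normr_sign !mulr1.
  rewrite ler_norml -(avg_cst 1).
  have <- : avg (fun=> -1) = - avg (fun=> 1) by rewrite !avg_cst.
  by apply/andP; split; apply: avg_le => g; have := lexx `|F g|; rewrite {2}h ler_norml => /andP[].
have odd x : ((x == a) (+) (x == b)) (+) ((x == c) (+) (x == d)) -> avg F = 0.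
  move=> hx; apply: (avg_odd (a := x)) => g; rewrite /F !sgn_flip.
  move: hx; rewrite ![_ == x]eq_sym.
  by (do 4 case: (x == _) => //=) => _; ring.
have [ca|ca] := eqVneq c a; have [db|db] := eqVneq d b.
- by rewrite ca db eqxx (le_trans le1) // lerDl ler0n.
- rewrite (odd b) ?normr0 ?addr_ge0 ?ler0n //.
  by rewrite eqxx ca (eq_sym b a) (eq_sym b d) (negbTE ab) (negbTE db).
- rewrite (odd a) ?normr0 ?addr_ge0 ?ler0n //.
  by rewrite eqxx db (eq_sym a c) (negbTE ab) (negbTE ca).
have [cb|cb] := eqVneq c b; have [da|da] := eqVneq d a.
- by rewrite cb da eqxx (le_trans le1) // lerDr ler0n.
- rewrite (odd a) ?normr0 ?addr_ge0 ?ler0n //.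
  by rewrite eqxx cb (eq_sym a d) (negbTE ab) (negbTE da).
- rewrite (odd b) ?normr0 ?addr_ge0 ?ler0n //.
  by rewrite eqxx da (eq_sym b a) (eq_sym b c) (negbTE ab) (negbTE cb).
rewrite (odd c) ?normr0 ?addr_ge0 ?ler0n //.
by rewrite eqxx (negbTE ca) (negbTE cb) (negbTE cd).
Qed.

Section QuadraticForm.
Variables (J : finType) (a b : J -> W) (f : J -> C).
Hypothesis ab_inj : injective (fun j => (a j, b j)).

(** All inner products of random vectors below take this form, one term for each pair of signs that
    get multiplied. *)
Definition qform g : C := \sum_j f j * (sgn g (a j) * sgn g (b j))%:C%C.

Lemma avg_Re_qform :
  avg (fun g => complex.Re (qform g)) = complex.Re (\sum_(j | a j == b j) f j).
Proof.
rewrite (eq_avg (F' := fun g => \sum_j complex.Re (f j) * (sgn g (a j) * sgn g (b j)))).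
  rewrite avg_sum Re_sum [RHS]big_mkcond; apply: eq_bigr => j _.
  by rewrite avgZ avg_sgn2; case: eqP; rewrite ?mulr1 ?mulr0.
by move=> g; rewrite Re_sum; apply: eq_bigr => j _; rewrite mulrC ReZ mulrC.
Qed.

Lemma normsqD (x y : C) : normsq (x + y) = normsq x + normsq y + 2 * complex.Re (x^* * y).
Proof. by case: x => ? ?; case: y => ? ?; rewrite /normsq /=; ring. Qed.

(** Bias plus variance. Terms with a j = b j are deterministic and form the bias; the others have
    mean zero. The pair (a j, b j) correlates only with itself and with its reversal, each attained
    by at most one index by injectivity, whence the factor 2. *)
Lemma avg_qform_le z :
  avg (fun g => normsq (qform g - z)) <=
  normsq (\sum_(j | a j == b j) f j - z) + 2 * \sum_j normsq (f j).
Proof.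
set D := _ - z.
pose h j := if a j == b j then 0 else f j.
pose Q' g := \sum_j h j * (sgn g (a j) * sgn g (b j))%:C%C.
have QE g : qform g - z = D + Q' g.
  rewrite /qform (bigID (fun j => a j == b j)) /= /D addrAC; congr (_ - _ + _).
    by apply: eq_bigr => j /eqP ->; rewrite sgn_sq mulr1.
  rewrite /Q' [RHS](bigID (fun j => a j == b j)) /= [X in _ = X + _]big1 ?add0r.
    by apply: eq_bigr => j /negbTE ab; rewrite /h ab.
  by move=> j ab; rewrite /h ab mul0r.
rewrite (eq_avg (F' := fun g => normsq D + normsq (Q' g) + 2 * complex.Re (D^* * Q' g))); last first.
  by move=> g; rewrite QE normsqD.
rewrite avgD (avgD (fun=> normsq D)) avg_cst avgZ.
have -> : avg (fun g => complex.Re (D^* * Q' g)) = 0.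
  rewrite (eq_avg (F' := fun g => \sum_j complex.Re (D^* * h j) * (sgn g (a j) * sgn g (b j)))).
    rewrite avg_sum big1 // => j _; rewrite avgZ avg_sgn2 /h.
    by case: eqP; rewrite ?mulr0 //= ?mul0r.
  move=> g; rewrite /Q' mulr_sumr Re_sum; apply: eq_bigr => j _.
  by rewrite mulrA mulrC ReZ mulrC.
rewrite mulr0 addr0 lerD2l.
have nQ g : normsq (Q' g) = \sum_j \sum_k complex.Re ((h j)^* * h k) *
    ((sgn g (a j) * sgn g (b j)) * (sgn g (a k) * sgn g (b k))).
  rewrite -[normsq _]ReR normsqE rmorph_sum mulr_suml Re_sum; apply: eq_bigr => j _.
  rewrite mulr_sumr Re_sum; apply: eq_bigr => k _.
  rewrite [RHS]mulrC -ReZ; congr complex.Re.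
  by rewrite rmorphM /= conjC_R [in RHS]rmorphM /=; ring.
rewrite (eq_avg nQ) avg_sum.
(* Indicators of the two pairings that survive in a fourth moment, both symmetric in j and k. *)
pose d1 j k := ((a k, b k) == (a j, b j))%:R : R.
pose d2 j k := ((a k, b k) == (b j, a j))%:R : R.
have d2C j k : d2 j k = d2 k j.
  by rewrite /d2 !xpair_eqE (eq_sym (a k)) (eq_sym (b k)) andbC.
have d1C j k : d1 j k = d1 k j by rewrite /d1 eq_sym.
have s1 j : \sum_k d1 j k <= 1.
  rewrite (bigD1 j) //= big1 ?addr0; first by rewrite /d1 eqxx.
  move=> k kj; rewrite /d1; case: eqP => // /ab_inj kj'.
  by rewrite kj' eqxx in kj.
have s2 j : \sum_k d2 j k <= 1.
  have [k0 k0E|hn] := pickP (fun k => (a k, b k) == (b j, a j)); last first.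
    by rewrite big1 // => k _; rewrite /d2 hn.
  rewrite (bigD1 k0) //= big1 ?addr0; first by rewrite /d2 k0E.
  move=> k kj; rewrite /d2; case: eqP => // e; move/eqP: k0E; rewrite -e => /ab_inj e'.
  by rewrite e' eqxx in kj.
apply: (@le_trans _ _ (\sum_j \sum_k (normsq (f j) + normsq (f k)) / 2 * (d1 j k + d2 j k))).
  apply: ler_sum => j _; rewrite avg_sum; apply: ler_sum => k _; rewrite avgZ.
  have r0 : 0 <= (normsq (f j) + normsq (f k)) / 2 * (d1 j k + d2 j k).
    by apply: mulr_ge0; [apply: divr_ge0 => //; apply: addr_ge0; exact: normsq_ge0|apply: addr_ge0; exact: ler0n].
  rewrite {1}/h; case: eqP => [_|/eqP abj]; first by rewrite rmorph0 !mul0r.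
  rewrite {1}/h; case: eqP => [_|/eqP abk]; first by rewrite mulr0 mul0r.
  apply: le_trans (ler_norm _) _; rewrite normrM.
  apply: ler_pM => //; last exact: avg_sgn4.
  case: (f j) => x y; case: (f k) => x' y'; rewrite /normsq /= ler_norml.
  have := sqr_ge0 (x - x'); have := sqr_ge0 (y - y').
  have := sqr_ge0 (x + x'); have := sqr_ge0 (y + y').
  by move=> ????; apply/andP; split; nra.
have -> : \sum_j \sum_k (normsq (f j) + normsq (f k)) / 2 * (d1 j k + d2 j k) =
   \sum_j normsq (f j) * (\sum_k d1 j k + \sum_k d2 j k).
  have e : \sum_j \sum_k normsq (f j) * (d1 j k + d2 j k) =
           \sum_j \sum_k normsq (f k) * (d1 j k + d2 j k).
    rewrite exchange_big; apply: eq_bigr => j _; apply: eq_bigr => k _.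
    by rewrite d1C d2C.
  have -> : \sum_j normsq (f j) * (\sum_k d1 j k + \sum_k d2 j k) =
     \sum_j \sum_k normsq (f j) * (d1 j k + d2 j k).
    by apply: eq_bigr => j _; rewrite -big_split mulr_sumr.
  transitivity ((\sum_j \sum_k normsq (f j) * (d1 j k + d2 j k) +
                 \sum_j \sum_k normsq (f k) * (d1 j k + d2 j k)) / 2); last first.
    by rewrite -e; field.
  rewrite -big_split mulr_suml; apply: eq_bigr => j _.
  rewrite -big_split mulr_suml; apply: eq_bigr => k _ /=.
  by field.
rewrite mulr_sumr; apply: ler_sum => j _.
rewrite mulrC; apply: ler_wpM2r; first exact: normsq_ge0.
by have := s1 j; have := s2 j; lra.
Qed.

End QuadraticForm.
End Rademacher.

(** * Random coding *)

Section Coding.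
Variable R : realType.
Local Notation C := R[i].

(** The adjoint of a contraction W is a contraction: expand |x - W y|^2 >= 0 at y = W^dagger x,
    where Re <x, W y> = |y|^2. *)
Lemma contraction_adjoint (A Z : finType) (w : A -> Z -> C) :
  (forall z, \sum_a normsq (dot (w a) z) <= nrm2 z) ->
  forall x : A -> C, nrm2 (fun z => \sum_a x a * w a z) <= nrm2 x.
Proof.
move=> h x; set y := fun z => _.
have hy := h y.
have e : nrm2 y = complex.Re (dot x (fun a => dot (w a) y)).
  by rewrite -[LHS]ReR nrm2E {1}/y dot_suml.
have := nrm2_ge0 (fun a => x a - dot (w a) y).
rewrite nrm2B -e => h2.
have : nrm2 (fun a => dot (w a) y) <= nrm2 y by [].
lra.
Qed.

Variables (X B : finType) (p : X -> R).
Variables (U : X -> B -> B -> C) (lam : X -> B -> R).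
Variables (Q : B -> B -> C) (q : B -> R).
Hypothesis p_ge0 : forall x, 0 <= p x.
Hypothesis p_sum1 : \sum_x p x = 1.
Hypothesis U_ob : forall x, orthobasis (U x).
Hypothesis Q_ob : orthobasis Q.
Hypothesis lam_ge0 : forall x i, 0 <= lam x i.
Hypothesis lam_sum1 : forall x, \sum_i lam x i = 1.
Hypothesis q_ge0 : forall t, 0 <= q t.
Hypothesis q_sum1 : \sum_t q t = 1.
Hypothesis average_state : forall a b,
  \sum_x (p x)%:C%C * (\sum_i (lam x i)%:C%C * (U x i a * (U x i b)^*)) =
  \sum_t (q t)%:C%C * (Q t a * (Q t b)^*).

Lemma average_state_coord t t' :
  \sum_x (p x)%:C%C * (\sum_i (lam x i)%:C%C * ((dot (Q t) (U x i))^* * dot (Q t') (U x i))) =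
  (t == t')%:R * (q t)%:C%C.
Proof.
transitivity (\sum_a \sum_b Q t a * (\sum_s (q s)%:C%C * (Q s b * (Q s a)^*)) * (Q t' b)^*).
  under [RHS]eq_bigr do under eq_bigr do rewrite -average_state mulr_sumr mulr_suml.
  under [RHS]eq_bigr do rewrite exchange_big /=.
  rewrite [RHS]exchange_big /=; apply: eq_bigr => x _.
  under [RHS]eq_bigr do under eq_bigr do rewrite mulrCA -mulrA.
  under [RHS]eq_bigr do rewrite -mulr_sumr.
  rewrite -mulr_sumr; congr (_ * _).
  under [RHS]eq_bigr do under eq_bigr do rewrite mulr_sumr mulr_suml.
  under [RHS]eq_bigr do rewrite exchange_big /=.
  rewrite [RHS]exchange_big /=; apply: eq_bigr => i _.
  rewrite dotC /dot mulr_suml mulr_sumr; apply: eq_bigr => a _.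
  by rewrite !mulr_sumr; apply: eq_bigr => b _; ring.
transitivity (\sum_s (q s)%:C%C * (dot (Q s) (Q t) * dot (Q t') (Q s))).
  under eq_bigr do under eq_bigr do rewrite mulr_sumr mulr_suml.
  under eq_bigr do rewrite exchange_big /=.
  rewrite exchange_big /=; apply: eq_bigr => s _.
  rewrite /dot mulr_suml mulr_sumr; apply: eq_bigr => a _.
  by rewrite !mulr_sumr; apply: eq_bigr => b _; ring.
under eq_bigr do rewrite !Q_ob.1.
rewrite (bigD1 t) //= big1 ?addr0 => [|s st]; last by rewrite (negbTE st) mul0r mulr0.
by rewrite eqxx mul1r mulrC eq_sym.
Qed.

(** For the linear map L with L Q_t = y_t, both sides are the trace of L rho L^dagger, rho being the
    mean state. An error independent of x is thus measured by [q] alone. *)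
Lemma average_state_nrm2 (Z : finType) (y : B -> Z -> C) :
  \sum_x p x * (\sum_i lam x i * nrm2 (fun z => \sum_t dot (Q t) (U x i) * y t z)) =
  \sum_t q t * nrm2 (y t).
Proof.
apply: complexI; rewrite !rmorph_sum /=.
transitivity (\sum_t \sum_t' dot (y t) (y t') *
   \sum_x (p x)%:C%C * (\sum_i (lam x i)%:C%C * ((dot (Q t) (U x i))^* * dot (Q t') (U x i)))).
  under [RHS]eq_bigr do under eq_bigr do rewrite mulr_sumr.
  under [RHS]eq_bigr do rewrite exchange_big /=.
  rewrite [RHS]exchange_big /=; apply: eq_bigr => x _.
  rewrite rmorphM rmorph_sum /= mulr_sumr.
  under [RHS]eq_bigr do under eq_bigr do rewrite !mulr_sumr.
  under [RHS]eq_bigr do rewrite exchange_big /=.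
  rewrite [RHS]exchange_big /=; apply: eq_bigr => i _.
  rewrite rmorphM /= nrm2E dot_suml !mulr_sumr; apply: eq_bigr => t _.
  by rewrite dot_sumr !mulr_sumr; apply: eq_bigr => t' _; ring.
apply: eq_bigr => t _.
under eq_bigr do rewrite average_state_coord mulrCA.
by rewrite (sum_deltal (fun t' => dot (y t) (y t') * (q t)%:C%C)) rmorphM /= nrm2E mulrC.
Qed.

Lemma normsq_nat_bool (b : bool) (x : C) : normsq (b%:R * x) = b%:R * normsq x.
Proof. by case: b; rewrite ?mul1r // !mul0r normsq0. Qed.

Lemma normsq_if (b : bool) (x : C) : normsq (b%:R * x) <= normsq x.
Proof. by case: b; rewrite ?mul1r // mul0r normsq0 normsq_ge0. Qed.

Variables (T : pred B) (I : X -> pred B) (K m : nat) (eta : R).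
Hypothesis K_gt0 : (0 < K)%N.
Hypothesis eta_gt0 : 0 < eta.

(** [v t] lists the images of [Q t] under all K Kraus operators. A unit vector in K m coordinates
    leaves squared length about 1/K to the block k, which sqrt K restores. *)
Definition decvec (v : B -> 'I_K * 'I_m -> C) (x : X) (a : 'I_K * B) (c : 'I_m) : C :=
  (I x a.2)%:R * ((Num.sqrt K%:R)%:C%C * \sum_t dot (Q t) (U x a.2) * v t (a.1, c)).

(** A lower bound for the average overlap that is polynomial in [v], so that it can be averaged over
    the signs. The first term is the estimate of [near_orthonormalization] for the decoder; the two
    terms in [eta] pay for making the encoder a contraction. *)
Definition quality (v : B -> 'I_K * 'I_m -> C) : R :=
  \sum_x p x * (\sum_(i | I x i) lam x i * (K%:R^-1 * \sum_k
     (3 * nrm2 (decvec v x (k, i))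
      - \sum_b normsq (dot (decvec v x (k, i)) (decvec v x b))) / 2))
  - eta / 2
  - (\sum_(t | T t) q t * (\sum_b normsq (dot (v t) (v b) - (t == b)%:R))) / (2 * eta).

(** The encoder is built from the orthonormalised [v], the decoder from the orthonormalised
    [decvec v]. Designing the decoder for [v] and not for its correction keeps the bound a function
    of [v]; the correction reappears as [Delta]. *)
Lemma code_of_vectors (v : B -> 'I_K * 'I_m -> C) :
  (forall t, ~~ T t -> forall z, v t z = 0) ->
  exists (A : 'I_K -> 'I_m -> B -> C) (D : X -> 'I_K -> B -> 'I_m -> C),
  [/\ forall z, \sum_k nrm2 (opapp (A k) z) <= nrm2 z,
      forall x z, \sum_k nrm2 (opapp (D x k) z) <= nrm2 z &
      quality v <= \sum_x p x * ((Num.sqrt K%:R)^-1 * complex.Re (\sum_k \sum_i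
        (lam x i)%:C%C * dot (U x i) (opapp (D x k) (opapp (A k) (U x i)))))].
Proof.
move=> vT.
have KR : 0 < K%:R :> R by rewrite ltr0n.
set sK : R := Num.sqrt K%:R.
have sK0 : 0 < sK by rewrite sqrtr_gt0.
have sKK : sK * sK = K%:R by rewrite -expr2 sqr_sqrtr // ltW.
have [vh [vh1 _ vh3]] := near_orthonormalization v.
pose A k c b := \sum_t ((T t)%:R * (Q t b)^*) * vh t (k, c) : C.
have wx_ex x := near_orthonormalization (decvec v x).
have [wx hwx] := choice wx_ex.
pose D x k b c := \sum_i ((I x i)%:R * U x i b) * (wx x (k, i) c)^* : C.
have AE k z c : opapp (A k) z c = \sum_t ((T t)%:R * dot (Q t) z) * vh t (k, c).
  rewrite /opapp /A; under eq_bigr do rewrite mulr_suml.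
  rewrite exchange_big; apply: eq_bigr => t _ /=.
  by rewrite /dot mulr_sumr mulr_suml; apply: eq_bigr => b _; ring.
have DE x k z b : opapp (D x k) z b = \sum_i ((I x i)%:R * dot (wx x (k, i)) z) * U x i b.
  rewrite /opapp /D; under eq_bigr do rewrite mulr_suml.
  rewrite exchange_big; apply: eq_bigr => i _ /=.
  by rewrite /dot mulr_sumr mulr_suml; apply: eq_bigr => c _; ring.
have nrm2_pair (F : 'I_K * 'I_m -> C) : \sum_k nrm2 (fun c => F (k, c)) = nrm2 F.
  by rewrite /nrm2 pair_bigA; apply: eq_bigr => -[].
exists A, D; split.
- move=> z.
  have -> : \sum_k nrm2 (opapp (A k) z) =
      nrm2 (fun kc => \sum_t ((T t)%:R * dot (Q t) z) * vh t kc).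
    by rewrite -nrm2_pair; apply: eq_bigr => k _; apply: eq_nrm2 => c; exact: AE.
  apply: le_trans (contraction_adjoint vh1 _) _.
  rewrite -(parseval z Q_ob); apply: ler_sum => t _; exact: normsq_if.
- move=> x z; have [wx1 _ _] := hwx x.
  apply: le_trans (wx1 z).
  rewrite (eq_bigr (fun k => \sum_i normsq ((I x i)%:R * dot (wx x (k, i)) z))); last first.
    by move=> k _; rewrite (eq_nrm2 (DE x k z)) nrm2_basis.
  rewrite pair_bigA; apply: ler_sum => -[k i] _ /=; exact: normsq_if.
pose y t (z : 'I_K * 'I_m) := (T t)%:R * (v t z - vh t z) : C.
pose Delta x i (z : 'I_K * 'I_m) := \sum_t dot (Q t) (U x i) * y t z.
have split_term x k i : I x i ->
   K%:R^-1 * ((3 * nrm2 (decvec v x (k, i))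
      - \sum_b normsq (dot (decvec v x (k, i)) (decvec v x b))) / 2) -
   (eta / K%:R + nrm2 (fun c => Delta x i (k, c)) / eta) / 2 <=
   sK^-1 * complex.Re (dot (wx x (k, i)) (opapp (A k) (U x i))).
  move=> Ixi; have [wx1 wx2 _] := hwx x.
  have w1 : nrm2 (wx x (k, i)) <= 1 by exact: dot_le1.
  have -> : sK^-1 * complex.Re (dot (wx x (k, i)) (opapp (A k) (U x i))) =
     K%:R^-1 * complex.Re (dot (wx x (k, i)) (decvec v x (k, i))) +
     sK^-1 * complex.Re (dot (wx x (k, i)) (fun c => - Delta x i (k, c))).
    have -> : K%:R^-1 = sK^-1 * sK^-1 by rewrite -invfM sKK.
    rewrite -mulrA -mulrDr; congr (_ * _).
    rewrite -ReZ -ReD; congr complex.Re; rewrite /dot mulr_sumr -big_split.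
    apply: eq_bigr => c _ /=; rewrite AE /decvec /= Ixi mul1r /Delta -sumrN.
    rewrite mulrCA -mulrDr; congr (_ * _).
    rewrite -/sK mulrA -rmorphM mulVf ?gt_eqF // mul1r -big_split /=.
    apply: eq_bigr => t _; rewrite /y; case: (boolP (T t)) => [_|nT]; first by rewrite !mul1r; ring.
    by rewrite (vT _ nT) !mul0r; ring.
  apply: lerD; first by rewrite ler_pM2l ?invr_gt0.
  (* With the weight eta / sqrt K, the K terms of the sum over k add up to half of eta + |Delta|^2 /
     eta. *)
  have e1 : 0 < eta / sK by rewrite divr_gt0.
  have h := Re_dot_ge (wx x (k, i)) (fun c => - Delta x i (k, c)) e1.
  apply: le_trans (_ : sK^-1 * (- (eta / sK * nrm2 (wx x (k, i)) +
       nrm2 (fun c => - Delta x i (k, c)) / (eta / sK)) / 2) <= _); last first.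
    by rewrite ler_pM2l ?invr_gt0.
  have -> : nrm2 (fun c => - Delta x i (k, c)) = nrm2 (fun c => Delta x i (k, c)).
    by apply: eq_bigr => c _; rewrite /normsq /=; case: (Delta _ _ _) => ? ?; rewrite /= !sqrrN.
  set d := nrm2 (fun c => _).
  have -> : sK^-1 * (- (eta / sK * nrm2 (wx x (k, i)) + d / (eta / sK)) / 2) =
     - (eta / K%:R * nrm2 (wx x (k, i)) + d / eta) / 2.
    by rewrite -sKK; field; rewrite !gt_eqF.
  have e2 : 0 < eta / K%:R by rewrite divr_gt0.
  have : eta / K%:R * nrm2 (wx x (k, i)) <= eta / K%:R by rewrite ler_piMr // ltW.
  lra.

have DU x k i z : dot (U x i) (opapp (D x k) z) = (I x i)%:R * dot (wx x (k, i)) z.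
  rewrite (eq_dot (fun=> erefl) (DE x k z)) dot_sumr.
  under eq_bigr do rewrite (U_ob x).1.
  by rewrite (sum_deltar (fun j => (I x j)%:R * dot (wx x (k, j)) z)).
have main x : \sum_(i | I x i) lam x i * (K%:R^-1 * \sum_k
     (3 * nrm2 (decvec v x (k, i))
      - \sum_b normsq (dot (decvec v x (k, i)) (decvec v x b))) / 2)
   - eta / 2 - (\sum_i lam x i * nrm2 (Delta x i)) / (2 * eta) <=
   sK^-1 * complex.Re (\sum_k \sum_i
        (lam x i)%:C%C * dot (U x i) (opapp (D x k) (opapp (A k) (U x i)))).
  have -> : sK^-1 * complex.Re (\sum_k \sum_i
        (lam x i)%:C%C * dot (U x i) (opapp (D x k) (opapp (A k) (U x i)))) =
     \sum_(i | I x i) lam x i * \sum_k (sK^-1 * complex.Re (dot (wx x (k, i)) (opapp (A k) (U x i)))).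
    rewrite exchange_big /= Re_sum mulr_sumr [RHS]big_mkcond; apply: eq_bigr => i _ /=.
    rewrite Re_sum; case: ifP => Ixi.
      rewrite !mulr_sumr; apply: eq_bigr => k _.
      by rewrite ReZ DU Ixi mul1r; ring.
    rewrite big1 ?mulr0 // => k _; rewrite DU Ixi mul0r mulr0 //.
  apply: (@le_trans _ _ (\sum_(i | I x i) lam x i * (K%:R^-1 * (\sum_k
     (3 * nrm2 (decvec v x (k, i))
      - \sum_b normsq (dot (decvec v x (k, i)) (decvec v x b))) / 2)
      - (eta + nrm2 (Delta x i) / eta) / 2))); last first.
    apply: ler_sum => i Ixi; apply: ler_wpM2l => //.
    apply: le_trans (ler_sum _ (fun k _ => split_term x k i Ixi)).
    rewrite sumrB mulr_sumr lerD2l lerN2 -mulr_suml big_split /= sumr_const card_ord.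
    rewrite -mulr_suml nrm2_pair -[_ *+ K]mulr_natr divfK ?gt_eqF //.
  have -> : \sum_(i | I x i) lam x i * (K%:R^-1 * (\sum_k
     (3 * nrm2 (decvec v x (k, i))
      - \sum_b normsq (dot (decvec v x (k, i)) (decvec v x b))) / 2)
      - (eta + nrm2 (Delta x i) / eta) / 2) =
    \sum_(i | I x i) lam x i * (K%:R^-1 * \sum_k
     (3 * nrm2 (decvec v x (k, i))
      - \sum_b normsq (dot (decvec v x (k, i)) (decvec v x b))) / 2) -
    \sum_(i | I x i) lam x i * ((eta + nrm2 (Delta x i) / eta) / 2).
    by rewrite -sumrB; apply: eq_bigr => i _; rewrite mulrBr.
  rewrite -addrA lerD2l -opprD lerN2.
  (* The loss is nonnegative, so it is extended from [I x] to all i; only the full sum can be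
     averaged by [average_state_nrm2]. *)
  apply: (@le_trans _ _ (\sum_i lam x i * ((eta + nrm2 (Delta x i) / eta) / 2))).
    rewrite [leRHS](bigID (I x)) /= lerDl sumr_ge0 // => i _.
    rewrite mulr_ge0 // divr_ge0 // addr_ge0 //; first exact: ltW.
    by rewrite divr_ge0 ?nrm2_ge0 // ltW.
  have -> : eta / 2 = \sum_i lam x i * (eta / 2) by rewrite -mulr_suml lam_sum1 mul1r.
  rewrite mulr_suml -big_split /=.
  apply: ler_sum => i _; rewrite le_eqVlt; apply/orP; left; apply/eqP.
  by field; rewrite gt_eqF.
apply: (@le_trans _ _ (\sum_x p x * (\sum_(i | I x i) lam x i * (K%:R^-1 * \sum_k
     (3 * nrm2 (decvec v x (k, i))
      - \sum_b normsq (dot (decvec v x (k, i)) (decvec v x b))) / 2)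
   - eta / 2 - (\sum_i lam x i * nrm2 (Delta x i)) / (2 * eta)))); last first.
  by apply: ler_sum => x _; apply: ler_wpM2l.
have -> : \sum_x p x * (\sum_(i | I x i) lam x i * (K%:R^-1 * \sum_k
     (3 * nrm2 (decvec v x (k, i))
      - \sum_b normsq (dot (decvec v x (k, i)) (decvec v x b))) / 2)
   - eta / 2 - (\sum_i lam x i * nrm2 (Delta x i)) / (2 * eta)) =
   \sum_x p x * (\sum_(i | I x i) lam x i * (K%:R^-1 * \sum_k
     (3 * nrm2 (decvec v x (k, i))
      - \sum_b normsq (dot (decvec v x (k, i)) (decvec v x b))) / 2))
  - eta / 2 - (\sum_x p x * (\sum_i lam x i * nrm2 (Delta x i))) / (2 * eta).
  have e2 : \sum_x p x * (eta / 2) = eta / 2 by rewrite -mulr_suml p_sum1 mul1r.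
  rewrite -[X in _ = _ - X - _]e2 mulr_suml -!sumrB.
  apply: eq_bigr => x _; rewrite -mulrA -!mulrBr //.
rewrite /quality lerD2l lerN2 ler_pM2r ?invr_gt0 ?mulr_gt0 //.
(* [y] does not depend on x, so its mean is weighted by [q]; atypical t contribute nothing because
   [y] carries the factor [T t]. *)
rewrite average_state_nrm2 [leRHS]big_mkcond; apply: ler_sum => t _ /=.
case: ifP => Tt; last first.
  by rewrite /nrm2 big1 ?mulr0 // => z _; rewrite /y Tt mul0r normsq0.
apply: ler_wpM2l => //; apply: le_trans (vh3 t).
by rewrite le_eqVlt; apply/orP; left; apply/eqP; apply: eq_nrm2 => z; rewrite /y Tt mul1r.
Qed.

(** * Moments of the random encoder and of its decoding vectors *)

Hypothesis m_gt0 : (0 < m)%N.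
Local Notation W := (('I_K * 'I_m) * B)%type.
Local Notation avg := (@avg R W).

(** Vanishing outside [T] bounds the number of Gram entries that fluctuate by N; the factor (K
    m)^(-1/2) makes the typical vectors exactly unit. *)
Definition random_vectors (g : {ffun W -> bool}) (t : B) (kc : 'I_K * 'I_m) : C :=
  (T t)%:R * ((Num.sqrt (K%:R * m%:R))^-1 * sgn R g (kc, t))%:C%C.

Lemma avg_linear (n : X -> 'I_K -> B -> {ffun W -> bool} -> R)
   (h : X -> 'I_K -> B -> 'I_K * B -> {ffun W -> bool} -> R)
   (e : B -> B -> {ffun W -> bool} -> R) (c : R) :
  avg (fun g => \sum_x p x * (\sum_(i | I x i) lam x i * (K%:R^-1 * \sum_k
     (3 * n x k i g - \sum_b h x k i b g) / 2)) - c
     - (\sum_(t | T t) q t * (\sum_b e t b g)) / (2 * eta)) =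
  \sum_x p x * (\sum_(i | I x i) lam x i * (K%:R^-1 * \sum_k
     (3 * avg (n x k i) - \sum_b avg (h x k i b)) / 2)) - c
     - (\sum_(t | T t) q t * (\sum_b avg (e t b))) / (2 * eta).
Proof.
rewrite avgD avgD; congr (_ + _ + _).
- rewrite avg_sum; apply: eq_bigr => x _; rewrite avgZ; congr (_ * _).
  rewrite avg_sum; apply: eq_bigr => i _; rewrite avgZ avgZ; congr (_ * (_ * _)).
  rewrite avg_sum; apply: eq_bigr => k _.
  rewrite (eq_avg (F' := fun g => 2^-1 * (3 * n x k i g + (-1) * \sum_b h x k i b g))); last first.
    by move=> g; rewrite mulN1r mulrC.
  by rewrite avgZ avgD !avgZ avg_sum mulN1r mulrC.
- exact: avg_cst.
rewrite (eq_avg (F' := fun g => (- (2 * eta)^-1) * (\sum_(t | T t) q t * (\sum_b e t b g)))); last first.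
  by move=> g; rewrite mulNr mulrC.
rewrite avgZ avg_sum mulNr mulrC; congr (- (_ * _)).
by apply: eq_bigr => t _; rewrite avgZ avg_sum.
Qed.

Lemma gram_vectors g t b : T t ->
  dot (random_vectors g t) (random_vectors g b) =
  qform (fun j : 'I_K * 'I_m => (j, t)) (fun j => (j, b))
    (fun=> (T b)%:R * ((K%:R * m%:R)^-1)%:C%C) g.
Proof.
move=> Tt; rewrite /dot /qform; apply: eq_bigr => j _.
rewrite /random_vectors Tt mul1r conjC_R.
have -> : (K%:R * m%:R)^-1 = (Num.sqrt (K%:R * m%:R))^-1 * (Num.sqrt (K%:R * m%:R))^-1 :> R.
  by rewrite -invfM -expr2 sqr_sqrtr // mulr_ge0 ?ler0n.
by rewrite !rmorphM /=; ring.
Qed.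

(** The deterministic part of the Gram entry is exactly the Kronecker delta, so only variance
    remains: K m terms of size (K m)^-2, doubled. *)
Lemma avg_gram_vectors t b : T t ->
  avg (fun g => normsq (dot (random_vectors g t) (random_vectors g b) - (t == b)%:R))
  <= 2 * (T b)%:R * (K%:R * m%:R)^-1.
Proof.
move=> Tt.
have Km0 : (K%:R * m%:R : R) != 0 by rewrite mulf_neq0 // pnatr_eq0 -lt0n.
rewrite (eq_avg (F' := fun g => normsq (qform (fun j : 'I_K * 'I_m => (j, t)) (fun j => (j, b))
    (fun=> (T b)%:R * ((K%:R * m%:R)^-1)%:C%C) g - (t == b)%:R))); last first.
  by move=> g; rewrite gram_vectors.
apply: le_trans (avg_qform_le _ _ _) _; first by move=> j j' [].
have -> : \sum_(j : 'I_K * 'I_m | (j, t) == (j, b)) ((T b)%:R * ((K%:R * m%:R)^-1)%:C%C) -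
   (t == b)%:R = 0 :> C.
  have [<-|tb] := eqVneq t b; last first.
    by rewrite big1 ?subr0 // => j; rewrite xpair_eqE (negbTE tb) andbF.
  rewrite (eq_bigl predT) => [|j]; last by rewrite eqxx.
  rewrite sumr_const card_prod !card_ord Tt mul1r -[_ *+ _]mulr_natr natrM.
  have -> : K%:R * m%:R = (K%:R * m%:R : R)%:C%C :> C by rewrite rmorphM /= !rmorph_nat.
  by rewrite -rmorphM mulVf // rmorph1 subrr.
rewrite normsq0 add0r sumr_const card_prod !card_ord normsq_nat_bool normsqR -[X in 2 * X <= _]mulr_natr natrM.
by rewrite le_eqVlt; apply/orP; left; apply/eqP; field; rewrite !pnatr_eq0 -!lt0n K_gt0 m_gt0.
Qed.

Let qt x t i : C := dot (Q t) (U x i).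
(** Weight of [U x i] on the typical subspace spanned by the [Q t]. *)
Let tau x i : R := \sum_t (T t)%:R * normsq (qt x t i).

(** A Gram entry of decoding vectors sums over one shared output coordinate and two indices t, t' in
    the basis [Q]. *)
Definition decJ := ('I_m * (B * B))%type.
Let deca (k : 'I_K) (j : decJ) : W := ((k, j.1), j.2.1).
Let decb (k : 'I_K) (j : decJ) : W := ((k, j.1), j.2.2).
Let decf x i i' (j : decJ) : C :=
  ((I x i')%:R * (m%:R^-1)%:C%C) *
   (((T j.2.1)%:R * qt x j.2.1 i)^* * ((T j.2.2)%:R * qt x j.2.2 i')).

Lemma gram_decvec g x k i l i' : I x i ->
  dot (decvec (random_vectors g) x (k, i)) (decvec (random_vectors g) x (l, i')) =
  qform (deca k) (decb l) (decf x i i') g.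
Proof.
move=> Ixi; rewrite /qform /decvec /= sum_pair; apply: eq_bigr => c _.
rewrite Ixi mul1r sum_pair rmorphM rmorph_sum /= conjC_R.
transitivity ((Num.sqrt K%:R)%:C%C * (Num.sqrt K%:R)%:C%C * ((I x i')%:R *
  ((\sum_t (dot (Q t) (U x i) * random_vectors g t (k, c))^*) *
   (\sum_t dot (Q t) (U x i') * random_vectors g t (l, c)))) : C); first by ring.
rewrite mulr_suml !mulr_sumr; apply: eq_bigr => t _; rewrite !mulr_sumr.
apply: eq_bigr => t' _; rewrite /random_vectors /decf /deca /decb /= /qt.
have -> : m%:R^-1 = Num.sqrt K%:R * Num.sqrt K%:R * ((Num.sqrt (K%:R * m%:R))^-1 * (Num.sqrt (K%:R * m%:R))^-1) :> R.
  rewrite -invfM -!expr2 !sqr_sqrtr ?mulr_ge0 ?ler0n //.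
  by field; rewrite !pnatr_eq0 -!lt0n K_gt0 m_gt0.
by rewrite !rmorphM /= !conjC_nat !conjC_R; ring.
Qed.

Lemma tau_le1 x i : tau x i <= 1.
Proof.
rewrite -(orthobasis_nrm2 (U_ob x) i) -(parseval _ Q_ob).
by apply: ler_sum => t _; case: (T t); rewrite ?mul1r // mul0r normsq_ge0.
Qed.

Lemma tau_ge0 x i : 0 <= tau x i.
Proof. by apply: sumr_ge0 => t _; rewrite mulr_ge0 ?ler0n ?normsq_ge0. Qed.

Let diag x i i' : C := \sum_t (T t)%:R * ((qt x t i)^* * qt x t i').

(** A sign meets itself only for k = l and t = t'. Summing over the m coordinates cancels 1/m and
    leaves the matrix element of the typical projector between [U x i] and [U x i']. *)
Lemma decf_diag x k l i i' :
  \sum_(j | deca k j == decb l j) decf x i i' j = (k == l)%:R * ((I x i')%:R * diag x i i').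
Proof.
have m0 : (m%:R : R) != 0 by rewrite pnatr_eq0 -lt0n.
rewrite big_mkcond sum_pair /=.
transitivity (\sum_(c < m) (m%:R^-1)%:C%C * ((k == l)%:R * ((I x i')%:R * diag x i i')) : C).
  apply: eq_bigr => c _; rewrite sum_pair /diag !mulr_sumr; apply: eq_bigr => t _.
  rewrite (bigD1 t) //= [X in _ + X]big1 ?addr0 => [|t' tt]; last first.
    by rewrite /deca /decb /= !xpair_eqE (eq_sym t) (negbTE tt) !andbF.
  rewrite /deca /decb /decf /= !xpair_eqE !eqxx !andbT.
  case: (k == l); last by rewrite mul0r mulr0.
  by rewrite rmorphM /= conjC_nat; case: (T t); rewrite ?mul1r ?mul0r ?mulr0 //; ring.
rewrite sumr_const card_ord -mulrnAl -[_ *+ m]mulr_natr.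
by rewrite -(rmorph_nat (real_complex R)) -rmorphM /= mulVf // mul1r.
Qed.

(** The sum factorises into [tau x i * tau x i'] times m coordinates of weight 1/m^2 each. *)
Lemma decf_sum x i i' : \sum_j normsq (decf x i i' j) <= (I x i')%:R * m%:R^-1.
Proof.
have mR : 0 < m%:R :> R by rewrite ltr0n.
have -> : \sum_j normsq (decf x i i' j) =
    (I x i')%:R * m%:R^-1 * (tau x i * tau x i').
  have e c t t' : normsq (decf x i i' (c, (t, t'))) =
     ((I x i')%:R * (m%:R^-1 ^+ 2)) * (((T t)%:R * normsq (qt x t i)) * ((T t')%:R * normsq (qt x t' i'))).
    by rewrite /decf /= normsqM [X in _ * X]normsqM normsqJ !normsq_nat_bool normsqR.
  apply: complexI.
  rewrite rmorph_sum sum_pair /=; under eq_bigr do rewrite sum_pair.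
  under eq_bigr do under eq_bigr do under eq_bigr do rewrite e.
  rewrite sumr_const card_ord.
  under eq_bigr do rewrite -rmorph_sum -!mulr_sumr.
  rewrite -rmorph_sum -mulr_sumr -mulr_suml -/(tau x i) -/(tau x i') -rmorphMn /=.
  by congr (_%:C%C); rewrite -[_ *+ m]mulr_natr; field; rewrite gt_eqF.
rewrite -[leRHS]mulr1; apply: ler_wpM2l.
  by rewrite mulr_ge0 ?ler0n // invr_ge0 ltW.
by have := tau_le1 x i; have := tau_le1 x i'; have := tau_ge0 x i; have := tau_ge0 x i'; nra.
Qed.

Lemma deca_inj k l : injective (fun j => (deca k j, decb l j)).
Proof. by move=> [c [t t']] [d [s s']] [-> -> _ ->]. Qed.

Lemma avg_nrm2_decvec x k i : I x i ->
  avg (fun g => nrm2 (decvec (random_vectors g) x (k, i))) = tau x i.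
Proof.
move=> Ixi.
rewrite (eq_avg (F' := fun g => complex.Re (qform (deca k) (decb k) (decf x i i) g))); last first.
  by move=> g; rewrite -gram_decvec // -nrm2E.
rewrite avg_Re_qform decf_diag eqxx Ixi !mul1r /diag Re_sum; apply: eq_bigr => t _.
by rewrite -normsqE -(rmorph_nat (real_complex R)) ReZ.
Qed.

(** Parseval in the basis [U x] for the typical projection of [U x i]. *)
Lemma diag_sum x i : \sum_i' normsq (diag x i i') = tau x i.
Proof.
pose w b := \sum_t ((T t)%:R * qt x t i) * Q t b : C.
have -> : tau x i = nrm2 w.
  by rewrite nrm2_basis //; apply: eq_bigr => t _; rewrite normsq_nat_bool.
rewrite -(parseval w (U_ob x)); apply: eq_bigr => i' _.
rewrite -normsqJ; congr normsq.
rewrite -[RHS]conjCK dotC dot_suml; congr (_^*).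
by apply: eq_bigr => t _; rewrite rmorphM /= conjC_nat /qt mulrA.
Qed.

(** The bias sums to [tau] over the block l = k; the variance adds at most 2/m for each of the at
    most K s pairs (l, i') with i' in [I x]. This is the crosstalk that K s << m makes small. *)
Lemma avg_gram_decvec x k i (s : R) : I x i -> #|I x|%:R <= s ->
  \sum_b avg (fun g => normsq (dot (decvec (random_vectors g) x (k, i))
                                   (decvec (random_vectors g) x b))) <=
  tau x i + 2 * (K%:R * s / m%:R).
Proof.
move=> Ixi Is.
have mR : 0 < m%:R :> R by rewrite ltr0n.
apply: (@le_trans _ _ (\sum_(b : 'I_K * B) ((k == b.1)%:R * normsq (diag x i b.2) +
     2 * ((I x b.2)%:R * m%:R^-1)))).
  apply: ler_sum => -[l i'] _ /=.
  rewrite (eq_avg (F' := fun g => normsq (qform (deca k) (decb l) (decf x i i') g - 0))); last first.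
    by move=> g; rewrite gram_decvec // subr0.
  apply: le_trans (avg_qform_le _ (@deca_inj k l) _) _.
  rewrite subr0 decf_diag; apply: lerD; last by rewrite ler_pM2l // decf_sum.
  rewrite !normsq_nat_bool; apply: ler_wpM2l; first exact: ler0n.
  by case: (I x i'); rewrite ?mul1r // mul0r normsq_ge0.
rewrite -(pair_bigA _ (fun l i' => (k == l)%:R * normsq (diag x i i') +
     2 * ((I x i')%:R * m%:R^-1))) /=.
under eq_bigr do rewrite big_split /= -mulr_sumr -mulr_sumr -mulr_suml diag_sum.
rewrite big_split /= -mulr_suml (bigD1 k) //= eqxx big1 ?addr0 ?mul1r; last first.
  by move=> l lk; rewrite eq_sym (negbTE lk).
rewrite lerD2l sumr_const card_ord -[_ *+ K]mulr_natr -natr_sum.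
have -> : (\sum_i' I x i')%N = #|I x| by rewrite -sum1_card [RHS]big_mkcond; apply: eq_bigr => j _; rewrite unfold_in; case: (I x j).
have -> : 2 * (#|I x|%:R / m%:R) * K%:R = 2 * (K%:R * #|I x|%:R / m%:R) :> R by ring.
by rewrite ler_pM2l // ler_pM2r ?invr_gt0 // ler_pM2l // ltr0n.
Qed.

(** Both sides are the trace of the mean state against the typical projector. *)
Lemma tau_average : \sum_x p x * (\sum_i lam x i * tau x i) = \sum_(t | T t) q t.
Proof.
rewrite [RHS]big_mkcond /=.
transitivity (\sum_t (T t)%:R * complex.Re (\sum_x (p x)%:C%C * (\sum_i (lam x i)%:C%C *
    ((dot (Q t) (U x i))^* * dot (Q t) (U x i))))).
  under [RHS]eq_bigr do rewrite Re_sum mulr_sumr.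
  rewrite [RHS]exchange_big; apply: eq_bigr => x _ /=.
  under [RHS]eq_bigr do rewrite ReZ mulrCA Re_sum mulr_sumr.
  rewrite -mulr_sumr exchange_big; congr (_ * _); apply: eq_bigr => i _ /=.
  rewrite /tau mulr_sumr; apply: eq_bigr => t _.
  by rewrite ReZ -normsqE ReR mulrCA.
apply: eq_bigr => t _; rewrite average_state_coord eqxx mul1r ReR.
by case: (T t); rewrite ?mul1r // mul0r.
Qed.

(** Some sign pattern attains the mean of [quality]. The subtracted terms are the conditional mass
    outside [I x], the crosstalk between decoding vectors, and the two costs of correcting the
    encoder. *)
Lemma good_vectors (s N : R) : (forall x, #|I x|%:R <= s) -> #|T|%:R <= N ->
  exists v : B -> 'I_K * 'I_m -> C, (forall t, ~~ T t -> forall z, v t z = 0) /\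
  \sum_(t | T t) q t - \sum_x p x * (\sum_(i | ~~ I x i) lam x i)
   - K%:R * s / m%:R - eta / 2 - N / (K%:R * m%:R * eta) <= quality v.
Proof.
move=> Is TN.
have mR : 0 < m%:R :> R by rewrite ltr0n.
have KR : 0 < K%:R :> R by rewrite ltr0n.
suff [g hg] : exists g, \sum_(t | T t) q t - \sum_x p x * (\sum_(i | ~~ I x i) lam x i)
   - K%:R * s / m%:R - eta / 2 - N / (K%:R * m%:R * eta) <= quality (random_vectors g).
  exists (random_vectors g); split=> // t /negbTE nT z.
  by rewrite /random_vectors nT mul0r.
apply: avg_exists.
rewrite (avg_linear (fun x k i g => nrm2 (decvec (random_vectors g) x (k, i)))
  (fun x k i b g => normsq (dot (decvec (random_vectors g) x (k, i)) (decvec (random_vectors g) x b)))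
  (fun t b g => normsq (dot (random_vectors g t) (random_vectors g b) - (t == b)%:R))).
apply: lerB; last first.
  rewrite ler_pdivrMr ?mulr_gt0 //.
  have -> : N / (K%:R * m%:R * eta) * (2 * eta) = 2 * N * (K%:R * m%:R)^-1.
    by field; rewrite !gt_eqF.
  apply: (@le_trans _ _ (\sum_(t | T t) q t * (2 * N * (K%:R * m%:R)^-1))).
    apply: ler_sum => t Tt; apply: ler_wpM2l => //.
    apply: le_trans (ler_sum _ (fun b _ => avg_gram_vectors b Tt)) _.
    rewrite -mulr_suml ler_pM2r ?invr_gt0 ?mulr_gt0 // -mulr_sumr ler_pM2l //.
    rewrite -natr_sum.
    have -> // : (\sum_b T b)%N = #|T|.
    by rewrite -sum1_card [RHS]big_mkcond; apply: eq_bigr => j _; rewrite unfold_in; case: (T j).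
  rewrite -mulr_suml ler_piMl //.
    rewrite !mulr_ge0 ?invr_ge0 ?mulr_ge0 ?ler0n //.
    exact: le_trans (ler0n _ _) TN.
  by rewrite -q_sum1 [leRHS](bigID T) /= lerDl sumr_ge0.
apply: lerB => //.
apply: (@le_trans _ _ (\sum_x p x * (\sum_(i | I x i) lam x i * (tau x i - K%:R * s / m%:R)))); last first.
  apply: ler_sum => x _; apply: ler_wpM2l => //; apply: ler_sum => i Ixi; apply: ler_wpM2l => //.
  (* The coefficient 3 is tuned for this cancellation: (3 tau - (tau + 2 K s / m)) / 2 = tau - K s /
     m. *)
  have h := avg_gram_decvec _ Ixi (Is x).
  apply: (@le_trans _ _ (K%:R^-1 * \sum_(k < K) (tau x i - K%:R * s / m%:R))).
    set y := tau x i - _.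
    by rewrite sumr_const card_ord -[y *+ K]mulr_natr mulrC mulfK // gt_eqF.
  rewrite ler_pM2l ?invr_gt0 //; apply: ler_sum => k _.
  by rewrite avg_nrm2_decvec //; have := h k; lra.
have Ks0 (x : X) : 0 <= K%:R * s / m%:R.
  apply: divr_ge0; last exact: ler0n.
  apply: mulr_ge0; first exact: ler0n.
  exact: le_trans (ler0n _ _) (Is x).
have e : \sum_x p x * (K%:R * s / m%:R) = K%:R * s / m%:R by rewrite -mulr_suml p_sum1 mul1r.
rewrite -[X in _ - X <= _]e -tau_average -!sumrB; apply: ler_sum => x _; rewrite -!mulrBr.
apply: ler_wpM2l => //.
have -> : \sum_(i | I x i) lam x i * (tau x i - K%:R * s / m%:R) =
   \sum_(i | I x i) lam x i * tau x i - (\sum_(i | I x i) lam x i) * (K%:R * s / m%:R).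
  by rewrite mulr_suml -sumrB; apply: eq_bigr => i _; rewrite mulrBr.
have h1 : (\sum_(i | I x i) lam x i) * (K%:R * s / m%:R) <= K%:R * s / m%:R.
  rewrite ler_piMl //; first exact: Ks0 x.
  by rewrite -[leRHS](lam_sum1 x) [leRHS](bigID (I x)) /= lerDl sumr_ge0.
have h2 : \sum_i lam x i * tau x i <= \sum_(i | I x i) lam x i * tau x i + \sum_(i | ~~ I x i) lam x i.
  rewrite [leLHS](bigID (I x)) /= lerD2l; apply: ler_sum => i _.
  by rewrite ler_piMr // tau_le1.
by clear Ks0; lra.
Qed.

End Coding.

(** * From vectors to channels: a one-shot fidelity bound *)

Section OneShot.
Variable R : realType.
Local Notation C := R[i].

Lemma overlap_kcomp (B E Z : finType) (psi : B * E -> C) (U : B -> B -> C) (lam : B -> R)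
    (J J' : finType) (D : J -> B -> Z -> C) (A : J' -> Z -> B -> C) j j' :
  (forall a b, \sum_r psi (a, r) * (psi (b, r))^* = \sum_i (lam i)%:C%C * (U i a * (U i b)^*)) ->
  overlap psi (kcomp D A (j, j')) =
  \sum_i (lam i)%:C%C * dot (U i) (opapp (D j) (opapp (A j') (U i))).
Proof.
move=> h; rewrite /overlap.
under eq_bigr do under eq_bigr do rewrite h mulr_sumr.
under eq_bigr do rewrite exchange_big /=.
rewrite exchange_big; apply: eq_bigr => i _ /=.
rewrite exchange_big /dot mulr_sumr; apply: eq_bigr => b _ /=.
rewrite /opapp /kcomp /= !mulr_sumr.
under eq_bigr do rewrite mulr_suml.
rewrite exchange_big; apply: eq_bigr => z _ /=.
by rewrite !mulr_sumr; apply: eq_bigr => a _; ring.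
Qed.

(** Both completed channels contain the K designed operators as [inl]; the other pairs are dropped
    from the entanglement fidelity. *)
Lemma ler_sum_pair_diag (J A B : finType) (F : (J + A) * (J + B) -> R) :
  (forall s, 0 <= F s) -> \sum_j F (inl j, inl j) <= \sum_s F s.
Proof.
move=> F0; rewrite (eq_bigr (fun s => F (s.1, s.2))) => [|[] //].
rewrite -(pair_bigA _ (fun s t => F (s, t))) /= big_sumType /= -[leLHS]addr0.
apply: lerD; last by apply: sumr_ge0 => a _; apply: sumr_ge0.
apply: ler_sum => j _; rewrite (bigD1 (inl j)) //= lerDl.
by apply: sumr_ge0.
Qed.

(** Let z be K^(-1/2) times the real part of the sum of the matched overlaps; Cauchy-Schwarz bounds
    the entanglement fidelity below by z^2. The outer 2 and -1 come from z^2 >= 2 z - 1, which lets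
    the mean over x pass through linearly. *)
Theorem one_shot_code (X TB TR : finType) (p : X -> R) (psi : X -> TB * TR -> C)
    (U : X -> TB -> TB -> C) (lam : X -> TB -> R) (Q : TB -> TB -> C) (q : TB -> R)
    (T : pred TB) (I : X -> pred TB) (K m : nat) (eta s N : R) :
  (forall x, 0 <= p x) -> \sum_x p x = 1 -> (forall x, nrm2 (psi x) = 1) ->
  (forall x, orthobasis (U x)) -> orthobasis Q ->
  (forall x i, 0 <= lam x i) -> (forall x, \sum_i lam x i = 1) ->
  (forall t, 0 <= q t) -> \sum_t q t = 1 ->
  (forall x a b, \sum_r psi x (a, r) * (psi x (b, r))^* =
                 \sum_i (lam x i)%:C%C * (U x i a * (U x i b)^*)) ->
  (forall a b, \sum_x (p x)%:C%C * \sum_r psi x (a, r) * (psi x (b, r))^* =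
               \sum_t (q t)%:C%C * (Q t a * (Q t b)^*)) ->
  (0 < K)%N -> (0 < m)%N -> 0 < eta ->
  (forall x, #|I x|%:R <= s) -> #|T|%:R <= N ->
  exists (E : op R TB -> op R 'I_m) (D : op R (X * 'I_m)%type -> op R (X * TB)%type),
  [/\ CPTP E, CPTP D &
      let omega := blk (fun x i j => (p x)%:C%C * ketbra (psi x) i j) in
      2 * (\sum_(t | T t) q t - \sum_x p x * (\sum_(i | ~~ I x i) lam x i)
           - K%:R * s / m%:R - eta / 2 - N / (K%:R * m%:R * eta)) - 1 <=
      fidelity omega (lift_l (fun M => D (lift_r E M)) omega)].
Proof.
move=> p0 p1 psi1 Uob Qob lam0 lam1 q0 q1 rhoE avgE K0 m0 eta0 Is TN.
have avgE' a b : \sum_x (p x)%:C%C * (\sum_i (lam x i)%:C%C * (U x i a * (U x i b)^*)) =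
  \sum_t (q t)%:C%C * (Q t a * (Q t b)^*).
  by rewrite -avgE; apply: eq_bigr => x _; rewrite rhoE.
have [v [vT hv]] := good_vectors p0 p1 Uob Qob lam0 lam1 q0 q1 avgE' K0 eta0 m0 Is TN.
have [A [Dk [hA hD hq]]] := code_of_vectors p0 p1 Uob Qob lam0 lam1 q0 avgE' I K0 eta0 vT.
(* [kraus_completion] asks for a state to dump into; [TB] is inhabited since [q] has total mass
   1. *)
have b0 : TB.
  case: (pickP (fun _ : TB => true)) => [b _ //|h]; exfalso.
  by move: q1; rewrite big_pred0 // => /eqP; rewrite eq_sym oner_eq0.
have [LE [LEl LEtp]] := kraus_completion (Ordinal m0) hA.
have LDex x : exists L' : ('I_K + 'I_m)%type -> TB -> 'I_m -> C,
    (forall j, L' (inl j) = Dk x j) /\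
    (forall a a', \sum_j \sum_b (L' j b a')^* * L' j b a = (a' == a)%:R).
  exact: (kraus_completion b0 (hD x)).
have [LD LDP] := choice LDex.
exists (kraus LE), (controlled (fun x => kraus (LD x))); split.
- exact: kraus_CPTP.
- by apply: controlled_CPTP => x; apply: kraus_CPTP; case: (LDP x).
move=> omega; rewrite /omega controlled_output.
apply: (@le_trans _ _ (\sum_x p x * complex.Re (expect (psi x)
   (lift_l (kraus (kcomp (LD x) LE)) (ketbra (psi x)))))); last first.
  apply: fidelity_blk => // x; first exact: lift_ketbra_psd.
  rewrite lift_tr; first by rewrite ketbra_tr psi1.
  by move=> M; rewrite -kraus_comp !kraus_tp //; case: (LDP x).
have := le_trans hv hq; set bnd := \sum_(t | T t) q t - _ - _ - _ - _ => hb.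
apply: (@le_trans _ _ (\sum_x p x * (2 * ((Num.sqrt K%:R)^-1 * complex.Re (\sum_k \sum_i
        (lam x i)%:C%C * dot (U x i) (opapp (Dk x k) (opapp (A k) (U x i))))) - 1))).
  under eq_bigr do rewrite mulrBr mulrCA mulr1.
  by rewrite sumrB -mulr_sumr p1 lerD2r ler_pM2l.
apply: ler_sum => x _; apply: ler_wpM2l => //.
rewrite expect_kraus.
set o := fun k => \sum_i (lam x i)%:C%C * dot (U x i) (opapp (Dk x k) (opapp (A k) (U x i))).
apply: (@le_trans _ _ (\sum_k normsq (o k))); last first.
  apply: le_trans (ler_sum_pair_diag _); last by move=> j; exact: normsq_ge0.
  apply: ler_sum => k _; rewrite (overlap_kcomp _ _ _ _ (rhoE x)) LEl.
  by have [-> _] := LDP x.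
have KR : 0 < K%:R :> R by rewrite ltr0n.
have h1 := normsq_sum_le o; rewrite card_ord in h1.
have h2 : complex.Re (\sum_k o k) ^+ 2 <= normsq (\sum_k o k) by rewrite /normsq lerDl sqr_ge0.
have h3 : ((Num.sqrt K%:R)^-1 * complex.Re (\sum_k o k)) ^+ 2 <= \sum_k normsq (o k).
  rewrite exprMn exprVn sqr_sqrtr ?ler0n // mulrC ler_pdivrMr // mulrC.
  exact: le_trans h2 h1.
have := sqr_ge0 ((Num.sqrt K%:R)^-1 * complex.Re (\sum_k o k) - 1).
rewrite -/o in h3 *; move: (_^-1 * _) h3 => z h3 h4.
by apply: le_trans h3; nra.
Qed.

End OneShot.

(** * Entropy and typicality *)

Section Entropy.
Variable R : realType.
Local Notation C := R[i].

(** The matrix of eigenvectors conjugates the operator to diagonal form and cancels in the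
    determinant over polynomials. *)
Lemma char_poly_specop (T : finType) (e : T -> T -> C) (d : T -> R) : orthobasis e ->
  char_poly (mx_of_op (specop e d)) = \prod_(m <- enum T) ('X - ((d m)%:C%C)%:P).
Proof.
move=> [ob1 ob2].
pose P : 'M[C]_#|T| := \matrix_(i, j) e (enum_val j) (enum_val i).
pose P' : 'M[C]_#|T| := \matrix_(i, j) (e (enum_val i) (enum_val j))^*.
pose D : 'rV[C]_#|T| := \row_j (d (enum_val j))%:C%C.
have sumE (F : T -> C) : \sum_(i < #|T|) F (enum_val i) = \sum_t F t.
  rewrite [RHS](reindex (@enum_val T T)) //=; exact: onW_bij (enum_val_bij T).
have P'P : P' *m P = 1%:M.
  apply/matrixP => i j; rewrite !mxE.
  under eq_bigr do rewrite !mxE.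
  by rewrite (sumE (fun t => (e (enum_val i) t)^* * e (enum_val j) t)) -/(dot (e (enum_val i)) (e (enum_val j))) ob1 (inj_eq enum_val_inj).
have PP' : P *m P' = 1%:M by exact: mulmx1C.
have ME : mx_of_op (specop e d) = P *m diag_mx D *m P'.
  apply/matrixP => i j; rewrite !mxE /specop -sumE; apply: eq_bigr => k _.
  by rewrite mul_mx_diag !mxE; ring.
pose c (M : 'M[C]_#|T|) := map_mx (@polyC C) M.
have cM A B : c (A *m B) = c A *m c B by exact: map_mxM.
have c1 : c 1%:M = 1%:M by exact: map_mx1.
rewrite /char_poly /char_poly_mx ME.
have -> : 'X%:M - map_mx (@polyC C) (P *m diag_mx D *m P') =
    c P *m ('X%:M - c (diag_mx D)) *m c P'.
  rewrite mulmxBr mulmxBl -!cM; congr (_ - _).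
  by rewrite scalar_mxC -mulmxA -cM PP' c1 mulmx1.
rewrite !det_mulmx mulrAC -det_mulmx -cM PP' c1 det1 mul1r.
have -> : 'X%:M - c (diag_mx D) = diag_mx (\row_j ('X - (D 0 j)%:P)).
  apply/matrixP => i j; rewrite !mxE; case: eqP => [->|_]; first by rewrite !mulr1n.
  by rewrite !mulr0n polyC0 subr0.
rewrite det_diag big_enum /= [RHS](reindex (@enum_val T T)) /=; last exact: onW_bij (enum_val_bij T).
by apply: eq_bigr => i _; rewrite !mxE.
Qed.

(** Measured in nats; at d t = 0 the factor [d t] kills the default value of [ln]. *)
Definition shannon (T : finType) (d : T -> R) : R := \sum_t - (d t * ln (d t)).

Lemma etafE (t : R) : 0 <= t -> etaf t = - (t * ln t) / ln 2.
Proof.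
rewrite /etaf /log2 le_eqVlt => /orP[/eqP <-|t0]; first by rewrite lexx mul0r oppr0 mul0r.
by rewrite leNgt t0 /= mulNr mulrA.
Qed.

(** [eigenvalues] is a chosen list, but a split polynomial determines its roots up to order, and the
    entropy is a symmetric sum. *)
Lemma vN_entropy_specop (T : finType) (e : T -> T -> C) (d : T -> R) :
  orthobasis e -> (forall m, 0 <= d m) ->
  vN_entropy (specop e d) = shannon d / ln 2.
Proof.
move=> ob d0; rewrite /vN_entropy /eigenvalues.
have cE : char_poly (mx_of_op (specop e d)) =
    \prod_(r <- [seq (d m)%:C%C | m <- enum T]) ('X - r%:P).
  by rewrite char_poly_specop // [RHS]big_map.
have h : exists rs : seq C, char_poly (mx_of_op (specop e d)) = \prod_(r <- rs) ('X - r%:P).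
  by eexists; exact: cE.
have := ClassicalEpsilon.epsilon_spec (inhabits [::]) _ h.
rewrite cE.
move=> /prod_XsubC_eq pe.
rewrite -(perm_big _ pe) /= [LHS]big_map big_enum /= /shannon mulr_suml.
by apply: eq_bigr => m _; rewrite etafE.
Qed.

Lemma ln_le_subr1 (x : R) : 0 < x -> ln x <= x - 1.
Proof. by move=> x0; have := @le_ln1Dx R (x - 1); rewrite addrCA subrr addr0; apply; lra. Qed.

(** Jensen for -x ln x, from the tangent bound ln (y / z) <= y / z - 1 at the mean y. If y = 0,
    every weighted term vanishes on its own. *)
Lemma concave_xlnx (J : finType) (w z : J -> R) :
  (forall j, 0 <= w j) -> \sum_j w j = 1 -> (forall j, 0 <= z j) ->
  \sum_j w j * - (z j * ln (z j)) <= - ((\sum_j w j * z j) * ln (\sum_j w j * z j)).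
Proof.
move=> w0 w1 z0; set y := \sum_j w j * z j.
have y0 : 0 <= y by apply: sumr_ge0 => j _; rewrite mulr_ge0.
have [yE|yN] := eqVneq y 0.
  rewrite yE mul0r oppr0 big1 // => j _.
  have wz0 k : 0 <= w k * z k by rewrite mulr_ge0.
  have : w j * z j <= y by rewrite /y (bigD1 j) //= lerDl sumr_ge0.
  rewrite yE => h; have {}h : w j * z j = 0 by apply/eqP; rewrite eq_le h wz0.
  by rewrite mulrN mulrA h mul0r oppr0.
have yp : 0 < y by rewrite lt_def yN.
have -> : - (y * ln y) = \sum_j w j * (- (z j * ln y)).
  by rewrite {1}/y mulr_suml -sumrN; apply: eq_bigr => j _; rewrite mulrN mulrA.
rewrite -subr_ge0 -sumrB.
apply: (@le_trans _ _ (\sum_j w j * (z j - y))).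
  by under eq_bigr do rewrite mulrBr; rewrite sumrB -mulr_suml w1 mul1r subrr.
apply: ler_sum => j _; rewrite -mulrBr; apply: ler_wpM2l => //.
have := z0 j; rewrite le_eqVlt => /orP[/eqP <-|zp]; first by rewrite !mul0r; lra.
have h := @ln_le_subr1 (y / z j) (divr_gt0 yp zp).
rewrite ln_div ?posrE // in h.
have : z j * (ln y - ln (z j)) <= z j * (y / z j - 1) by rewrite ler_pM2l.
rewrite mulrBr [X in _ <= X]mulrBr mulrCA mulfV ?gt_eqF // mulr1; lra.
Qed.

End Entropy.

(** * Variance and Chebyshev bound for independent letters *)

Section Typicality.
Variable R : realType.

Lemma sum_prod_ffun (K : comNzRingType) (I J : finType) (F : I -> J -> K) :
  \sum_(f : {ffun I -> J}) \prod_i F i (f i) = \prod_i \sum_j F i j.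
Proof. by rewrite bigA_distr_bigA. Qed.

Variables (A : finType) (P f : A -> R).
Hypothesis P0 : forall a, 0 <= P a.
Hypothesis P1 : \sum_a P a = 1.
Let mu := \sum_a P a * f a.
Let V := \sum_a P a * (f a - mu) ^+ 2.

Lemma iid_variance n :
  \sum_(a : {ffun 'I_n -> A}) (\prod_i P (a i)) * (\sum_i (f (a i) - mu)) ^+ 2 = n%:R * V.
Proof.
pose phi a := f a - mu.
have phi0 : \sum_a P a * phi a = 0.
  by under eq_bigr do rewrite mulrBr; rewrite sumrB -mulr_suml P1 mul1r subrr.
(* The conditionals insert the deviation at coordinates j and k only, so each term is a product over
   coordinates; for distinct j and k the factor at j is the mean deviation 0. *)
transitivity (\sum_(j < n) \sum_(k < n) \sum_(a : {ffun 'I_n -> A})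
   \prod_i (P (a i) * ((if i == j then phi (a i) else 1) * (if i == k then phi (a i) else 1)))).
  under [RHS]eq_bigr do rewrite exchange_big /=.
  rewrite [RHS]exchange_big; apply: eq_bigr => a _ /=.
  rewrite expr2 mulr_suml mulr_sumr; apply: eq_bigr => j _; rewrite !mulr_sumr.
  apply: eq_bigr => k _; rewrite !big_split /=; congr (_ * (_ * _)).
    by rewrite -big_mkcond big_pred1_eq.
  by rewrite -big_mkcond big_pred1_eq.
transitivity (\sum_(j < n) V); last by rewrite sumr_const card_ord -[LHS]mulr_natl.
apply: eq_bigr => j _; rewrite (bigD1 j) //= [X in _ + X]big1 ?addr0 => [|k kj].
  rewrite (sum_prod_ffun (fun i a => P a * ((if i == j then phi a else 1) * (if i == j then phi a else 1)))).
  rewrite (bigD1 j) //= eqxx [X in _ * X]big1 ?mulr1 // => i ij.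
  by rewrite (negbTE ij); under eq_bigr do rewrite !mulr1.
rewrite (sum_prod_ffun (fun i a => P a * ((if i == j then phi a else 1) * (if i == k then phi a else 1)))).
rewrite (bigD1 j) //= eqxx eq_sym (negbTE kj).
by under eq_bigr do rewrite mulr1; rewrite phi0 mul0r.
Qed.

(** One-sided, since a sequence fails the typicality tests below only when -ln of its probability is
    too large. *)
Lemma iid_chebyshev n (delta : R) : 0 < delta ->
  \sum_(a : {ffun 'I_n -> A} | n%:R * mu + delta < \sum_i f (a i)) \prod_i P (a i)
  <= n%:R * V / delta ^+ 2.
Proof.
move=> d0; rewrite ler_pdivlMr ?exprn_gt0 // -iid_variance mulr_suml.
have pr0 (a : {ffun 'I_n -> A}) : 0 <= \prod_i P (a i) by apply: prodr_ge0.
rewrite [leRHS](bigID (fun a : {ffun 'I_n -> A} => n%:R * mu + delta < \sum_i f (a i))) /=.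
rewrite -[leLHS]addr0; apply: lerD; last first.
  by apply: sumr_ge0 => a _; rewrite mulr_ge0 ?sqr_ge0.
apply: ler_sum => a ha; apply: ler_wpM2l => //.
have -> : \sum_i (f (a i) - mu) = \sum_i f (a i) - n%:R * mu.
  by rewrite sumrB sumr_const card_ord -[mu *+ n]mulr_natl.
rewrite ler_sqr ?nnegrE ?ltW //; lra.
Qed.

End Typicality.

(** * Memoryless source *)

Section TypicalSets.
Variable R : realType.

Lemma card_typical (A : finType) (w : A -> R) (c : R) :
  (forall a, 0 <= w a) -> \sum_a w a = 1 ->
  #|[pred a | expR (- c) <= w a]|%:R <= expR c.
Proof.
move=> w0 w1; rewrite -[expR c]invrK -expRN -[leRHS]mul1r ler_pdivlMr ?expR_gt0 //.
rewrite -[leRHS]w1 [leRHS](bigID [pred a | expR (- c) <= w a]) /= -[leLHS]addr0.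
apply: lerD; last by apply: sumr_ge0.
rewrite mulr_natl -sumr_const.
by apply: ler_sum => a; rewrite inE.
Qed.

Lemma ln_prod_gt0 (I : finType) (F : I -> R) : (forall i, 0 < F i) ->
  ln (\prod_i F i) = \sum_i ln (F i).
Proof.
move=> F0.
have [_ ->] : 0 < \prod_i F i /\ ln (\prod_i F i) = \sum_i ln (F i); last by [].
elim/big_ind2: _ => [|x1 x2 y1 y2 [h1 <-] [h2 <-]|i _].
- by split=> //; rewrite ln1.
- by split; [exact: mulr_gt0|rewrite lnM ?posrE].
- by split.
Qed.

(** Sequences are drawn from [P] but tested against [w]: for conditional spectra, [P] is the joint
    law of (x, i) and [w] the eigenvalue of i given x. *)
Lemma atypical_bound (A : finType) (P w : A -> R) n (delta mu : R) :
  (forall a, 0 <= P a) -> \sum_a P a = 1 -> (forall a, 0 <= w a) ->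
  (forall a, w a = 0 -> P a = 0) -> 0 < delta ->
  \sum_a P a * - ln (w a) = mu ->
  \sum_(a : {ffun 'I_n -> A} | ~~ (expR (- (n%:R * mu + delta)) <= \prod_i w (a i)))
    \prod_i P (a i) <= (n%:R * \sum_a P a * (- ln (w a) - mu) ^+ 2) / delta ^+ 2.
Proof.
move=> P0 P1 w0 wP d0 muE.
have := iid_chebyshev (fun a => - ln (w a)) P0 P1 n d0; rewrite muE; apply: le_trans.
rewrite big_mkcond [leRHS]big_mkcond; apply: ler_sum => a _ /=.
have pr0 : 0 <= \prod_i P (a i) by apply: prodr_ge0.
case: ifP => h; last by case: ifP.
case: ifP => // /negP h2; rewrite le_eqVlt; apply/orP; left; apply/eqP.
(* At a zero factor [ln] takes a default value and the logarithm of the product no longer splits;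
   such sequences have probability 0 by [wP]. *)
have [/existsP[i /eqP wi]|/existsPn hN] := boolP [exists i, w (a i) == 0].
  by rewrite (bigD1 i) //= wP // mul0r.
have wp i : 0 < w (a i) by rewrite lt_def hN w0.
case: h2; rewrite sumrN -ln_prod_gt0 // ltrNr.
rewrite -ltr_expR lnK ?posrE ?prodr_gt0 //; by rewrite ltNge.
Qed.

(** Lets a pair of sequences (x^n, i^n) be treated as one sequence of independent pairs. *)
Lemma sum_ffun_pair (K : nmodType) (I A B : finType) (F : {ffun I -> A} -> {ffun I -> B} -> K) :
  \sum_f \sum_g F f g =
  \sum_(h : {ffun I -> A * B}) F [ffun i => (h i).1] [ffun i => (h i).2].
Proof.
rewrite pair_bigA (reindex (fun h : {ffun I -> A * B} =>
   ([ffun i => (h i).1], [ffun i => (h i).2]))) //=.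
exists (fun fg : {ffun I -> A} * {ffun I -> B} => [ffun i => (fg.1 i, fg.2 i)]) => [h _|[f g] _] /=.
  by apply/ffunP => i; rewrite !ffunE /=; case: (h i).
by congr pair; apply/ffunP => i; rewrite !ffunE.
Qed.

End TypicalSets.

(** * Tensor products of eigenbases and spectra *)

Section TensorPower.
Variable R : realType.
Local Notation C := R[i].

Lemma prod_delta (I J : finType) (f g : {ffun I -> J}) :
  \prod_i (f i == g i)%:R = (f == g)%:R :> C.
Proof.
have [->|/eqP fg] := eqVneq f g; first by rewrite big1 // => i _; rewrite eqxx.
have [i fgi] : exists i, f i != g i.
  apply/existsP; apply: contraT; rewrite negb_exists => /forallP h.
  by case: fg; apply/ffunP => i; apply/eqP; have := h i; rewrite negbK.
by rewrite (bigD1 i) //= (negbTE fgi) mul0r.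
Qed.

Lemma tensor_orthobasis (n : nat) (B : finType) (e : 'I_n -> B -> B -> C) :
  (forall j, orthobasis (e j)) ->
  orthobasis (fun (t b : {ffun 'I_n -> B}) => \prod_j e j (t j) (b j)).
Proof.
move=> he; split=> [t t'|a b].
  rewrite /dot -prod_delta.
  under [LHS]eq_bigr do rewrite rmorph_prod -big_split /=.
  rewrite (sum_prod_ffun (fun j b => (e j (t j) b)^* * e j (t' j) b)).
  by apply: eq_bigr => j _; exact: (he j).1.
rewrite /=; under [LHS] eq_bigr do rewrite rmorph_prod -big_split /=.
rewrite (sum_prod_ffun (fun j m => e j m (a j) * (e j m (b j))^*)) -prod_delta.
by apply: eq_bigr => j _; exact: (he j).2.
Qed.

Lemma tensor_specop (n : nat) (B : finType) (e : 'I_n -> B -> B -> C) (d : 'I_n -> B -> R)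
    (a b : {ffun 'I_n -> B}) :
  \prod_j (\sum_i (d j i)%:C%C * (e j i (a j) * (e j i (b j))^*)) =
  \sum_(t : {ffun 'I_n -> B}) (\prod_j d j (t j))%:C%C *
     ((\prod_j e j (t j) (a j)) * (\prod_j e j (t j) (b j))^*).
Proof.
rewrite -(sum_prod_ffun (fun j i => (d j i)%:C%C * (e j i (a j) * (e j i (b j))^*))).
by apply: eq_bigr => t _; rewrite !big_split /= !rmorph_prod.
Qed.

End TensorPower.

(** * The n-letter source and its entropies *)

Section Source.
Variable R : realType.
Local Notation C := R[i].
Variables (X TB TR : finType) (p : X -> R) (psi : X -> TB * TR -> C).
Hypothesis p_ge0 : forall x, 0 <= p x.
Hypothesis p_sum1 : \sum_x p x = 1.
Hypothesis psi_unit : forall x, nrm2 (psi x) = 1.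

Definition reduced x : op R TB := fun a b => \sum_r psi x (a, r) * (psi x (b, r))^*.
Definition avg_reduced : op R TB := fun a b => \sum_x (p x)%:C%C * reduced x a b.

Lemma reduced_psd x : psd (reduced x).
Proof.
move=> v; have -> : \sum_i \sum_j (v i)^* * reduced x i j * v j =
    \sum_r (\sum_i (v i)^* * psi x (i, r)) * (\sum_i (v i)^* * psi x (i, r))^*.
  under eq_bigr do under eq_bigr do rewrite mulr_sumr mulr_suml.
  under eq_bigr do rewrite exchange_big /=.
  rewrite exchange_big; apply: eq_bigr => r _ /=.
  rewrite mulr_suml; apply: eq_bigr => i _; rewrite rmorph_sum mulr_sumr.
  by apply: eq_bigr => j _; rewrite rmorphM /= conjCK; ring.
by apply: sumr_ge0 => r _; rewrite mulrC -normsqE ler0c normsq_ge0.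
Qed.

Lemma avg_reduced_psd : psd avg_reduced.
Proof.
move=> v; have -> : \sum_i \sum_j (v i)^* * avg_reduced i j * v j =
    \sum_x (p x)%:C%C * \sum_i \sum_j (v i)^* * reduced x i j * v j.
  under eq_bigr do under eq_bigr do rewrite mulr_sumr mulr_suml.
  under eq_bigr do rewrite exchange_big /=.
  rewrite exchange_big; apply: eq_bigr => x _ /=; rewrite mulr_sumr.
  by apply: eq_bigr => i _; rewrite mulr_sumr; apply: eq_bigr => j _; ring.
by apply: sumr_ge0 => x _; rewrite mulr_ge0 ?ler0c //; exact: reduced_psd.
Qed.

Lemma reduced_tr x : optr (reduced x) = 1.
Proof.
have -> : optr (reduced x) = (nrm2 (psi x))%:C%C.
  rewrite nrm2E /dot sum_pair; apply: eq_bigr => a _; apply: eq_bigr => r _.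
  by rewrite mulrC.
by rewrite psi_unit.
Qed.

Lemma avg_reduced_tr : optr avg_reduced = 1.
Proof.
rewrite /optr exchange_big /=.
under eq_bigr => x _ do rewrite -mulr_sumr -/(optr (reduced x)) reduced_tr mulr1.
by rewrite -rmorph_sum /= p_sum1.
Qed.

Variables (U : X -> TB -> TB -> C) (lam : X -> TB -> R).
Variables (Q : TB -> TB -> C) (q : TB -> R).
Hypothesis U_ob : forall x, orthobasis (U x).
Hypothesis Q_ob : orthobasis Q.
Hypothesis lam_ge0 : forall x i, 0 <= lam x i.
Hypothesis q_ge0 : forall t, 0 <= q t.
Hypothesis reducedE : forall x, reduced x = specop (U x) (lam x).
Hypothesis avg_reducedE : avg_reduced = specop Q q.

Lemma lam_sum1 x : \sum_i lam x i = 1.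
Proof. by have := reduced_tr x; rewrite reducedE specop_tr // => /complexI. Qed.

Lemma q_sum1 : \sum_t q t = 1.
Proof. by have := avg_reduced_tr; rewrite avg_reducedE specop_tr // => /complexI. Qed.

Definition joint_spectrum (a : X * TB) : R := p a.1 * lam a.1 a.2.

Lemma joint_sum1 : \sum_a joint_spectrum a = 1.
Proof.
rewrite -(pair_bigA _ (fun x i => p x * lam x i)) /=.
by under eq_bigr do rewrite -mulr_sumr lam_sum1 mulr1.
Qed.

Lemma joint_ge0 a : 0 <= joint_spectrum a.
Proof. by rewrite mulr_ge0. Qed.

Lemma entropy_B : vN_entropy (ptrace_l (ptrace_r (omegaXBR p psi))) = shannon q / ln 2.
Proof.
rewrite -(vN_entropy_specop Q_ob q_ge0) -avg_reducedE; congr vN_entropy.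
apply/funext => a; apply/funext => b; apply: eq_bigr => x _.
rewrite /ptrace_r /omegaXBR /= eqxx mulr_sumr.
by apply: eq_bigr => r _; rewrite mulrA.
Qed.

Lemma entropy_XB : vN_entropy (ptrace_r (omegaXBR p psi)) = shannon joint_spectrum / ln 2.
Proof.
(* Eigenbasis of the state on XB: each |x> tensored with the eigenvectors [U x i] of its own
   conditional state. *)
pose e (s t : X * TB) : C := (s.1 == t.1)%:R * U s.1 s.2 t.2.
have obe : orthobasis e.
  split=> -[x i] [y j].
    rewrite /dot sum_pair (bigD1 x) //= [X in _ + X]big1 ?addr0 => [|z zx]; last first.
      by rewrite big1 // => b _; rewrite /e /= eq_sym (negbTE zx) mul0r rmorph0 mul0r.
    rewrite /e /= eqxx xpair_eqE; have [->|xy] := eqVneq y x.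
      by rewrite /= -(U_ob x).1; apply: eq_bigr => b _; rewrite !mul1r.
    by rewrite /= big1 // => b _; rewrite mul0r mulr0.
  rewrite sum_pair (bigD1 x) //= [X in _ + X]big1 ?addr0 => [|z zx]; last first.
    by rewrite big1 // => b _; rewrite /e /= (negbTE zx) !mul0r.
  rewrite /e /= eqxx xpair_eqE; have [->|xy] := eqVneq x y.
    by rewrite /= -(U_ob y).2; apply: eq_bigr => b _; rewrite !mul1r.
  by rewrite /= big1 // => b _; rewrite mul0r rmorph0 mulr0.
rewrite -(vN_entropy_specop obe joint_ge0); congr vN_entropy.
apply/funext => -[x a]; apply/funext => -[y b].
rewrite /ptrace_r /omegaXBR /specop sum_pair (bigD1 x) //= [X in _ = _ + X]big1 ?addr0 => [|z zx]; last first.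
  by rewrite big1 // => i _; rewrite /e /= (negbTE zx) !mul0r mulr0.
case: eqP => [<-|/eqP xy]; last first.
  rewrite big1 // big1 // => i _.
  by rewrite /e /= (negbTE xy) mul0r rmorph0 !mulr0.
have := congr1 (fun M : op R TB => M a b) (reducedE x); rewrite /reduced /specop => h.
transitivity ((p x)%:C%C * \sum_r psi x (a, r) * (psi x (b, r))^*).
  by rewrite mulr_sumr; apply: eq_bigr => r _; rewrite mulrA.
rewrite h mulr_sumr; apply: eq_bigr => i _.
by rewrite /e /joint_spectrum /= eqxx !mul1r rmorphM /= mulrA.
Qed.

Lemma entropy_X : vN_entropy (ptrace_r (ptrace_r (omegaXBR p psi))) = shannon p / ln 2.
Proof.
pose e (x y : X) : C := (x == y)%:R.
have obe : orthobasis e.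
  split=> x y; rewrite /e /dot.
    under eq_bigr do rewrite conjC_nat.
    by rewrite (sum_deltal (fun i => (y == i)%:R)) eq_sym.
  under eq_bigr do rewrite conjC_nat eq_sym.
  by rewrite (sum_deltal (fun i => (i == y)%:R)).
rewrite -(vN_entropy_specop obe p_ge0); congr vN_entropy.
apply/funext => x; apply/funext => y.
rewrite /specop /e (bigD1 x) //= big1 ?addr0 => [|z zx]; last by rewrite (negbTE zx) mul0r mulr0.
rewrite eqxx mul1r conjC_nat /ptrace_r /omegaXBR /=.
case: eqP => [_|_]; last by rewrite mulr0 big1 // => b _; rewrite big1.
have := reduced_tr x; rewrite /optr /reduced => h.
rewrite -[RHS]/((p x)%:C%C * 1) -h mulr_sumr; apply: eq_bigr => b _; rewrite mulr_sumr.
by apply: eq_bigr => r _; rewrite mulrA.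
Qed.

(** S(B|X) in nats, as the mean entropy of the conditional states; [rate_formula] identifies it with
    S(XB) - S(X) up to the factor ln 2. *)
Definition cond_entropy : R := \sum_x p x * shannon (lam x).

(** Chain rule. Zero values of [p x] and [lam x i] are split off because the logarithm of the
    product splits only for positive factors. *)
Lemma shannon_joint : shannon joint_spectrum = shannon p + cond_entropy.
Proof.
rewrite /shannon -(pair_bigA _ (fun x i => - ((p x * lam x i) * ln (p x * lam x i)))) /=.
rewrite /cond_entropy -big_split; apply: eq_bigr => x _ /=.
rewrite -[X in _ = X + _]mul1r -(lam_sum1 x) /shannon mulr_suml mulr_sumr -big_split.
apply: eq_bigr => i _ /=.
have := p_ge0 x; rewrite le_eqVlt => /orP[/eqP <-|px]; first by rewrite !mul0r !(oppr0, mulr0) addr0.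
have := lam_ge0 x i; rewrite le_eqVlt => /orP[/eqP <-|lx].
  by rewrite !(mulr0, mul0r, oppr0) addr0.
by rewrite lnM ?posrE //; ring.
Qed.

Lemma rate_formula :
  (vN_entropy (ptrace_l (ptrace_r (omegaXBR p psi))) +
   (vN_entropy (ptrace_r (omegaXBR p psi)) -
    vN_entropy (ptrace_r (ptrace_r (omegaXBR p psi))))) / 2 =
  (shannon q + cond_entropy) / 2 / ln 2.
Proof. by rewrite entropy_B entropy_XB entropy_X shannon_joint; ring. Qed.

Lemma average_state a b :
  \sum_x (p x)%:C%C * (\sum_i (lam x i)%:C%C * (U x i a * (U x i b)^*)) =
  \sum_t (q t)%:C%C * (Q t a * (Q t b)^*).
Proof.
have := congr1 (fun M : op R TB => M a b) avg_reducedE; rewrite /specop => <-.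
by apply: eq_bigr => x _; rewrite reducedE.
Qed.

Lemma spectrum_ge0_le1 x i : 0 <= lam x i <= 1.
Proof.
by rewrite lam_ge0 /= -(lam_sum1 x) (bigD1 i) //= lerDl sumr_ge0.
Qed.

Lemma cond_entropy_ge0 : 0 <= cond_entropy.
Proof.
apply: sumr_ge0 => x _; rewrite mulr_ge0 //; apply: sumr_ge0 => i _.
have /andP[l0 l1] := spectrum_ge0_le1 x i.
by rewrite oppr_ge0 mulr_ge0_le0 // ln_le0.
Qed.

(** Each [q t] is a convex combination of the [lam x i] with weights p x |<Q t, U x i>|^2, and these
    weights sum over t to p x; Jensen is applied for each t. The result keeps the exponent of K
    nonnegative. *)
Lemma cond_entropy_le : cond_entropy <= shannon q.
Proof.
have qE t : q t = \sum_(a : X * TB) (p a.1 * normsq (dot (Q t) (U a.1 a.2))) * lam a.1 a.2.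
  have := average_state_coord Q_ob average_state t t; rewrite eqxx mul1r => h.
  rewrite -[LHS]ReR -h.
  rewrite -(pair_bigA _ (fun x i => (p x * normsq (dot (Q t) (U x i))) * lam x i)) Re_sum.
  apply: eq_bigr => x _ /=; rewrite ReZ Re_sum mulr_sumr; apply: eq_bigr => i _.
  by rewrite ReZ -normsqE ReR; ring.
have w1 t : \sum_(a : X * TB) p a.1 * normsq (dot (Q t) (U a.1 a.2)) = 1.
  rewrite -(pair_bigA _ (fun x i => p x * normsq (dot (Q t) (U x i)))) /= -[RHS]p_sum1.
  apply: eq_bigr => x _; rewrite -mulr_sumr -[RHS]mulr1; congr (_ * _).
  rewrite -(orthobasis_nrm2 Q_ob t) -(parseval _ (U_ob x)); apply: eq_bigr => i _.
  by rewrite -normsqJ dotC.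
have -> : cond_entropy = \sum_t \sum_(a : X * TB)
   (p a.1 * normsq (dot (Q t) (U a.1 a.2))) * - (lam a.1 a.2 * ln (lam a.1 a.2)).
  rewrite exchange_big /= /cond_entropy.
  rewrite -(pair_bigA _ (fun x i => \sum_t (p x * normsq (dot (Q t) (U x i))) * - (lam x i * ln (lam x i)))).
  apply: eq_bigr => x _; rewrite mulr_sumr; apply: eq_bigr => i _ /=.
  by rewrite -mulr_suml -mulr_sumr parseval // (orthobasis_nrm2 (U_ob x)) mulr1.
apply: ler_sum => t _; rewrite qE; apply: concave_xlnx => // -[x i].
by rewrite mulr_ge0 ?normsq_ge0.
Qed.

Lemma omega_extE n : omega_ext n p psi =
  blk (fun (x : {ffun 'I_n -> X}) i j => (\prod_j p (x j))%:C%C * ketbra (psi_n psi x) i j).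
Proof.
apply/funext => -[[x a] [x' r]]; apply/funext => -[[y b] [y' r']].
by rewrite /omega_ext /blk /ketbra; case: ifP => // _; rewrite mulrA.
Qed.

Lemma psi_n_reduced n (x : {ffun 'I_n -> X}) (a b : {ffun 'I_n -> TB}) :
  \sum_r psi_n psi x (a, r) * (psi_n psi x (b, r))^* = \prod_j reduced (x j) (a j) (b j).
Proof.
rewrite /reduced -(sum_prod_ffun (fun j r => psi (x j) (a j, r) * (psi (x j) (b j, r))^*)).
by apply: eq_bigr => r _; rewrite /psi_n rmorph_prod -big_split.
Qed.

Lemma psi_n_unit n (x : {ffun 'I_n -> X}) : nrm2 (psi_n psi x) = 1.
Proof.
apply: complexI; rewrite nrm2E /dot sum_pair.
transitivity (\sum_(a : {ffun 'I_n -> TB}) \prod_j reduced (x j) (a j) (a j)).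
  apply: eq_bigr => a _; rewrite -psi_n_reduced; apply: eq_bigr => r _.
  by rewrite mulrC.
rewrite (sum_prod_ffun (fun j a => reduced (x j) a a)) big1 // => j _.
exact: reduced_tr.
Qed.

(** [V] adds the variances of -ln q under q and of -ln lam under the joint law. It does not depend
    on n, so the atypical mass is of order n / delta^2. *)
Lemma block_code : exists V : R, 0 <= V /\
  forall (n K m : nat) (delta eta : R), 0 < delta -> 0 < eta -> (0 < K)%N -> (0 < m)%N ->
  exists (E : op R (nseqT n TB) -> op R 'I_m)
         (D : op R (nseqT n X * 'I_m)%type -> op R (nseqT n X * nseqT n TB)%type),
  [/\ CPTP E, CPTP D &
    1 - 2 * (n%:R * V / delta ^+ 2 + K%:R * expR (n%:R * cond_entropy + delta) / m%:R + eta / 2 +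
             expR (n%:R * shannon q + delta) / (K%:R * m%:R * eta))
    <= fidelity (omega_ext n p psi) (code_output E D (omega_ext n p psi))].
Proof.
have muq : \sum_t q t * - ln (q t) = shannon q.
  by apply: eq_bigr => t _; rewrite mulrN.
have muj : \sum_a joint_spectrum a * - ln (lam a.1 a.2) = cond_entropy.
  rewrite -(pair_bigA _ (fun x i => (p x * lam x i) * - ln (lam x i))) /=.
  by apply: eq_bigr => x _; rewrite mulr_sumr; apply: eq_bigr => i _ /=; ring.
pose V1 := \sum_t q t * (- ln (q t) - shannon q) ^+ 2.
pose V2 := \sum_a joint_spectrum a * (- ln (lam a.1 a.2) - cond_entropy) ^+ 2.
exists (V1 + V2); split.
  apply: addr_ge0; apply: sumr_ge0 => a _; rewrite mulr_ge0 ?sqr_ge0 //; exact: joint_ge0.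
move=> n K m delta eta d0 eta0 K0 m0.
pose T : pred {ffun 'I_n -> TB} := fun t => expR (- (n%:R * shannon q + delta)) <= \prod_j q (t j).
pose I (x : {ffun 'I_n -> X}) : pred {ffun 'I_n -> TB} :=
  fun i => expR (- (n%:R * cond_entropy + delta)) <= \prod_j lam (x j) (i j).
have pn0 (x : {ffun 'I_n -> X}) : 0 <= \prod_j p (x j) by apply: prodr_ge0.
have qn0 (t : {ffun 'I_n -> TB}) : 0 <= \prod_j q (t j) by apply: prodr_ge0.
have lamn0 (x : {ffun 'I_n -> X}) (i : {ffun 'I_n -> TB}) : 0 <= \prod_j lam (x j) (i j).
  by apply: prodr_ge0.
have pn1 : \sum_(x : {ffun 'I_n -> X}) \prod_j p (x j) = 1.
  by rewrite (sum_prod_ffun (fun _ => p)) big1.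
have qn1 : \sum_(t : {ffun 'I_n -> TB}) \prod_j q (t j) = 1.
  by rewrite (sum_prod_ffun (fun _ => q)) big1 // => _ _; exact: q_sum1.
have lamn1 (x : {ffun 'I_n -> X}) : \sum_(i : {ffun 'I_n -> TB}) \prod_j lam (x j) (i j) = 1.
  by rewrite (sum_prod_ffun (fun j => lam (x j))) big1 // => j _; exact: lam_sum1.
have rhoN (x : {ffun 'I_n -> X}) (a b : {ffun 'I_n -> TB}) :
    \sum_r psi_n psi x (a, r) * (psi_n psi x (b, r))^* =
    \sum_(i : {ffun 'I_n -> TB}) (\prod_j lam (x j) (i j))%:C%C *
      ((\prod_j U (x j) (i j) (a j)) * (\prod_j U (x j) (i j) (b j))^*).
  rewrite psi_n_reduced.
  under eq_bigr do rewrite reducedE /specop.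
  exact: (tensor_specop (fun j => U (x j)) (fun j => lam (x j))).
have avgN (a b : {ffun 'I_n -> TB}) :
    \sum_(x : {ffun 'I_n -> X}) (\prod_j p (x j))%:C%C *
      (\sum_r psi_n psi x (a, r) * (psi_n psi x (b, r))^*) =
    \sum_(t : {ffun 'I_n -> TB}) (\prod_j q (t j))%:C%C *
      ((\prod_j Q (t j) (a j)) * (\prod_j Q (t j) (b j))^*).
  rewrite -(tensor_specop (fun _ => Q) (fun _ => q)).
  transitivity (\prod_j avg_reduced (a j) (b j)); last by apply: eq_bigr => j _; rewrite avg_reducedE.
  rewrite /avg_reduced -(sum_prod_ffun (fun j x => (p x)%:C%C * reduced x (a j) (b j))).
  by apply: eq_bigr => x _; rewrite psi_n_reduced big_split /= rmorph_prod.
(* This count holds for every x^n, typical or not; an atypical x^n only loses mass, which [hI]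
   controls on average. *)
have cardI x : #|I x|%:R <= expR (n%:R * cond_entropy + delta).
  exact: (card_typical _ (lamn0 x) (lamn1 x)).
have cardT : #|T|%:R <= expR (n%:R * shannon q + delta).
  exact: (card_typical _ qn0 qn1).
have [E [D [hE hD hF]]] := @one_shot_code R {ffun 'I_n -> X} {ffun 'I_n -> TB} {ffun 'I_n -> TR}
  (fun x => \prod_j p (x j)) (psi_n psi)
  (fun x i b => \prod_j U (x j) (i j) (b j)) (fun x i => \prod_j lam (x j) (i j))
  (fun t b => \prod_j Q (t j) (b j)) (fun t => \prod_j q (t j))
  T I K m eta (expR (n%:R * cond_entropy + delta)) (expR (n%:R * shannon q + delta))
  pn0 pn1 (@psi_n_unit n)
  (fun x => tensor_orthobasis (fun j => U_ob (x j)))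
  (tensor_orthobasis (fun _ => Q_ob)) lamn0 lamn1 qn0 qn1
  rhoN avgN K0 m0 eta0 cardI cardT.
exists E, D; split=> //; rewrite omega_extE.
apply: le_trans hF.
have hT : \sum_(t | ~~ T t) \prod_j q (t j) <= n%:R * V1 / delta ^+ 2.
  exact: (@atypical_bound R TB q q n delta _ q_ge0 q_sum1 q_ge0 (fun _ h => h) d0 muq).
have hI : \sum_(x : {ffun 'I_n -> X}) (\prod_j p (x j)) * (\sum_(i : {ffun 'I_n -> TB} | ~~ I x i) \prod_j lam (x j) (i j)) <=
    n%:R * V2 / delta ^+ 2.
  have h0 a : lam a.1 a.2 = 0 -> joint_spectrum a = 0 by rewrite /joint_spectrum => ->; rewrite mulr0.
  have := @atypical_bound R (X * TB)%type joint_spectrum (fun a => lam a.1 a.2) n delta _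
    joint_ge0 joint_sum1 (fun a => lam_ge0 a.1 a.2) h0 d0 muj.
  apply: le_trans.
  pose G (x : {ffun 'I_n -> X}) (i : {ffun 'I_n -> TB}) :=
    if ~~ I x i then (\prod_j p (x j)) * (\prod_j lam (x j) (i j)) else 0.
  rewrite (eq_bigr (fun x => \sum_i G x i)) => [|x _]; last first.
    by rewrite mulr_sumr big_mkcond.
  rewrite sum_ffun_pair [leRHS]big_mkcond; apply: ler_sum => h _.
  rewrite /G /I.
  have -> : \prod_j lam ([ffun i => (h i).1] j) ([ffun i => (h i).2] j) =
            \prod_j lam (h j).1 (h j).2 by apply: eq_bigr => j _; rewrite !ffunE.
  have -> : \prod_j p ([ffun i => (h i).1] j) = \prod_j p (h j).1.
    by apply: eq_bigr => j _; rewrite ffunE.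
  by rewrite -big_split.
have hqT : \sum_(t | T t) \prod_j q (t j) = 1 - \sum_(t | ~~ T t) \prod_j q (t j).
  by rewrite -[X in X - _]qn1 [X in X - _](bigID T) /= addrK.
rewrite hqT; move: hT hI; set a := \sum_(_ | _) _; set b := \sum_x _.
have -> : n%:R * (V1 + V2) / delta ^+ 2 = n%:R * V1 / delta ^+ 2 + n%:R * V2 / delta ^+ 2 by ring.
lra.
Qed.

End Source.

(** * Rate *)

Local Open Scope classical_set_scope.
Local Open Scope ring_scope.

Section Asymptotics.
Variable R : realType.

Definition root4 n : R := Num.sqrt (Num.sqrt n.+1%:R).

Lemma root4_ge1 n : 1 <= root4 n.
Proof.
by rewrite /root4 -{1}sqrtr1 ler_wsqrtr // -{1}sqrtr1 ler_wsqrtr // ler1n.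
Qed.

Lemma root4_exp4 n : root4 n ^+ 4 = n.+1%:R.
Proof.
by rewrite /root4 (exprM _ 2 2) sqr_sqrtr ?sqrtr_ge0 // sqr_sqrtr ?ler0n.
Qed.

Lemma root4_gt0 n : 0 < root4 n.
Proof. exact: lt_le_trans ltr01 (root4_ge1 n). Qed.

Lemma cvg_root4V : (fun n => (root4 n)^-1) @ \oo --> (0 : R).
Proof.
apply/cvgrPdist_lt => e e0.
have e4 : 0 < e ^+ 4 by rewrite exprn_gt0.
have /cvgrPdist_lt/(_ _ e4) h := @cvg_harmonic R.
near=> n.
have : `|0 - @harmonic R n| < e ^+ 4 by near: n; exact: h.
rewrite !sub0r !normrN /harmonic /= -root4_exp4 -exprVn !ger0_norm ?exprn_ge0 ?invr_ge0 ?(ltW (root4_gt0 n)) //.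
have v0 : 0 <= (root4 n)^-1 by rewrite invr_ge0 ltW // root4_gt0.
by rewrite ltr_pXn2r // nnegrE // ltW.
Unshelve. all: by end_near.
Qed.

(** Rounds e^x up to a positive integer, at the price of a factor at most 2 when x >= 0. *)
Definition nat_above (x : R) : nat := (Num.truncn (expR x)).+1.

Lemma nat_above_gt x : expR x < (nat_above x)%:R.
Proof. exact: truncnS_gt. Qed.

Lemma nat_above_le x : 0 <= x -> (nat_above x)%:R <= 2 * expR x.
Proof.
move=> x0; rewrite /nat_above -natr1.
have h : 1 <= expR x by rewrite -(expR0 R) ler_expR.
have : (Num.truncn (expR x))%:R <= expR x by rewrite truncn_le expR_ge0.
lra.
Qed.

(** Both typical-set sizes carry e^delta; the 2 delta in [m] turns it into e^(-delta), at most u^-2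
    because e^delta >= 1 + delta >= u^2. In the last term one power of u is spent on 1/eta. The four
    terms are at most V/u, 2/u, 1/(2u) and 1/u. *)
Lemma error_terms (S h V : R) (n : nat) : 0 <= h -> h <= S -> 0 <= V ->
  let u := root4 n in let delta := u ^+ 3 in
  let K := nat_above (n%:R * ((S - h) / 2)) in
  let m := nat_above (n%:R * ((S + h) / 2) + 2 * delta) in
  n%:R * V / delta ^+ 2 + K%:R * expR (n%:R * h + delta) / m%:R + u^-1 / 2 +
    expR (n%:R * S + delta) / (K%:R * m%:R * u^-1) <= (V + 4) / u.
Proof.
move=> h0 hS V0; rewrite /=; set u := root4 n; set delta := u ^+ 3.
set a := n%:R * ((S - h) / 2); set b := _ + 2 * delta.
have u1 : 1 <= u := root4_ge1 n.
have u0 : 0 < u := root4_gt0 n.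
have d0 : 0 < delta by rewrite exprn_gt0.
have a0 : 0 <= a by rewrite mulr_ge0 ?ler0n // divr_ge0 // subr_ge0.
have b0 : 0 <= b.
  apply: addr_ge0; last by rewrite mulr_ge0 // ltW.
  by rewrite mulr_ge0 ?ler0n // divr_ge0 //; lra.
have K1 := nat_above_gt a; have K2 := nat_above_le a0.
have m1 := nat_above_gt b.
have ea := expR_gt0 a; have eb := expR_gt0 b.
set K := nat_above a in K1 K2 *; set m := nat_above b in m1 *.
have K0 : 0 < K%:R :> R by exact: lt_trans ea K1.
have m0 : 0 < m%:R :> R by exact: lt_trans eb m1.
have ed : expR (- delta) <= u^-1 ^+ 2.
  rewrite expRN exprVn lef_pV2 ?posrE ?expR_gt0 ?exprn_gt0 //.
  apply: le_trans (expR_ge1Dx delta).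
  have : u ^+ 2 <= delta by rewrite /delta [u ^+ 3]exprS ler_peMl // exprn_ge0 // ltW.
  lra.
have v0 : 0 < u^-1 by rewrite invr_gt0.
have v1 : u^-1 <= 1 by rewrite invf_le1.
have vv : u^-1 ^+ 2 <= u^-1 by rewrite expr2 ler_piMl // ltW.
have t1 : n%:R * V / delta ^+ 2 <= V / u.
  have nu : n%:R <= u ^+ 4 by rewrite root4_exp4 ler_nat.
  apply: (@le_trans _ _ (u ^+ 4 * V / delta ^+ 2)).
    by rewrite ler_pM2r ?invr_gt0 ?exprn_gt0 // ler_wpM2r.
  have -> : u ^+ 4 * V / delta ^+ 2 = V * u^-1 ^+ 2 by rewrite /delta; field; rewrite gt_eqF.
  by apply: ler_wpM2l.
have t2 : K%:R * expR (n%:R * h + delta) / m%:R <= 2 / u.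
  rewrite ler_pdivrMr //.
  apply: (@le_trans _ _ (2 * expR a * expR (n%:R * h + delta))).
    by rewrite ler_pM2r ?expR_gt0.
  have -> : 2 * expR a * expR (n%:R * h + delta) = 2 * expR (- delta) * expR b.
    by rewrite -!mulrA -!expRD; congr (_ * expR _); rewrite /a /b; field.
  apply: ler_pM; rewrite ?mulr_ge0 ?expR_ge0 ?ler0n //; last exact: ltW.
  by rewrite ler_pM2l //; exact: le_trans ed vv.
have t3 : expR (n%:R * S + delta) / (K%:R * m%:R * u^-1) <= u^-1.
  rewrite ler_pdivrMr ?mulr_gt0 //.
  have -> : expR (n%:R * S + delta) = expR (- delta) * (expR a * expR b).
    by rewrite -!expRD; congr expR; rewrite /a /b; field.
  have -> : u^-1 * (K%:R * m%:R * u^-1) = u^-1 ^+ 2 * (K%:R * m%:R) by ring.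
  apply: ler_pM; rewrite ?mulr_ge0 ?expR_ge0 //.
  by apply: ler_pM; rewrite ?expR_ge0 // ltW.
have -> : (V + 4) / u = V / u + 2 / u + u^-1 + u^-1 by field; rewrite gt_eqF.
lra.
Qed.

Lemma cvg_rate (r : R) : 0 <= r ->
  (fun n => log2 (nat_above (n%:R * r + 2 * root4 n ^+ 3))%:R / n%:R) @ \oo --> r / ln 2.
Proof.
move=> r0.
have l2 : 0 < ln 2 :> R by rewrite ln_gt0 // ltr1n.
(* For n >= 1, ln m exceeds n r by at most (2 + ln 2) u^3, and u^3 = u^4 / u <= 2 n / u; hence 4 + 2
   ln 2. *)
pose c : R := (4 + 2 * ln 2) / ln 2.
apply: (@squeeze_cvgr _ _ _ _ (fun=> r / ln 2) (fun n => r / ln 2 + c * (root4 n)^-1)).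
- near=> n.
  have n0 : 0 < n%:R :> R by rewrite ltr0n; near: n; exact: nbhs_infty_gt.
  set u := root4 n; set x := n%:R * r + 2 * u ^+ 3.
  have u0 : 0 < u := root4_gt0 n.
  have u1 : 1 <= u := root4_ge1 n.
  have x0 : 0 <= x by rewrite addr_ge0 ?mulr_ge0 ?exprn_ge0 // ltW.
  have lo : x <= ln (nat_above x)%:R.
    by rewrite -[leLHS]expRK ler_ln ?posrE ?expR_gt0 ?ltr0n // ltW // nat_above_gt.
  have hi : ln (nat_above x)%:R <= ln 2 + x.
    rewrite -[X in _ + X]expRK -lnM ?posrE ?expR_gt0 // ler_ln ?posrE ?ltr0n ?mulr_gt0 ?expR_gt0 //.
    exact: nat_above_le.
  rewrite /log2; apply/andP; split.
    rewrite ler_pdivlMr // ler_pdivlMr //.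
    have -> : r / ln 2 * n%:R * ln 2 = n%:R * r by field; rewrite gt_eqF.
    by apply: le_trans lo; rewrite /x lerDl mulr_ge0 ?exprn_ge0 // ltW.
  rewrite ler_pdivrMr // ler_pdivrMr //.
  apply: le_trans hi _.
  have -> : (r / ln 2 + c / u) * n%:R * ln 2 = n%:R * r + (4 + 2 * ln 2) / u * n%:R.
    by rewrite /c; field; rewrite !gt_eqF.
  have nu : u ^+ 4 <= 2 * n%:R.
    rewrite root4_exp4 -natr1; have : 1 <= n%:R :> R by rewrite ler1n -(ltr0n R).
    lra.
  have : (4 + 2 * ln 2) / u * (u ^+ 4 / 2) <= (4 + 2 * ln 2) / u * n%:R.
    apply: ler_wpM2l; last by lra.
    by rewrite divr_ge0 ?(ltW u0) // addr_ge0 ?mulr_ge0 // ltW.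
  have -> : (4 + 2 * ln 2) / u * (u ^+ 4 / 2) = 2 * u ^+ 3 + ln 2 * u ^+ 3 by field; rewrite gt_eqF.
  have : ln 2 <= ln 2 * u ^+ 3 by rewrite ler_peMr ?exprn_ege1 // ltW.
  rewrite /x; lra.
- exact: cvg_cst.
rewrite -[X in _ --> X]addr0; apply: cvgD; first exact: cvg_cst.
rewrite -[X in _ --> X](mulr0 c); apply: cvgM; first exact: cvg_cst.
exact: cvg_root4V.
Unshelve. all: by end_near.
Qed.

End Asymptotics.

Theorem theorem5p2 (R : realType) (X TB TR : finType) (p : X -> R)
  (psi : X -> qvec R (TB * TR)%type)
  (p_ge0 : forall x, 0 <= p x) (p_sum1 : \sum_(x : X) p x = 1)
  (psi_unit : forall x, \sum_(br : (TB * TR)%type) `|psi x br| ^+ 2 = 1) :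
  let w := omegaXBR p psi in
  let wXB := ptrace_r w in
  let wB := ptrace_l wXB in
  let wX := ptrace_r wXB in
  let RB := (vN_entropy wB + (vN_entropy wXB - vN_entropy wX)) / 2 in
  exists (m : nat -> nat) (eps : nat -> R)
         (E : forall n, op R (nseqT n TB) -> op R 'I_(m n))
         (D : forall n, op R (nseqT n X * 'I_(m n))%type -> op R (nseqT n X * nseqT n TB)%type),
    [/\ forall n, (0 < m n)%N,
        forall n, CPTP (E n) /\ CPTP (D n),
        forall n, fidelity (omega_ext n p psi)
                    (code_output (E n) (D n) (omega_ext n p psi)) >= 1 - eps n,
        eps @ \oo --> 0
      & (fun n => log2 (m n)%:R / n%:R) @ \oo --> RB].
Proof.
move=> w wXB wB wX RB.
have psi1 x : nrm2 (psi x) = 1.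
  apply: complexI; rewrite rmorph_sum /= -[RHS](psi_unit x).
  by apply: eq_bigr => br _; rewrite normsq_norm.
have [U hU] := choice (fun x => psd_specop (reduced_psd psi x)).
have [lam hlam] := choice hU.
have Uob x : orthobasis (U x) by case: (hlam x).
have lam0 x i : 0 <= lam x i by case: (hlam x).
have redE x : reduced psi x = specop (U x) (lam x) by case: (hlam x).
have [Q [q [Qob q0 avgE]]] := psd_specop (avg_reduced_psd psi p_ge0).
pose S := shannon q; pose h := cond_entropy p lam.
have h0 : 0 <= h := cond_entropy_ge0 p_ge0 psi1 Uob lam0 redE.
have hS : h <= S := cond_entropy_le p_ge0 p_sum1 Uob Qob lam0 redE avgE.
have RBE : RB = (S + h) / 2 / ln 2 := rate_formula p_ge0 psi1 Uob Qob lam0 q0 redE avgE.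
have [V [V0 code]] := block_code p_ge0 p_sum1 psi1 Uob Qob lam0 q0 redE avgE.
pose m n := nat_above (n%:R * ((S + h) / 2) + 2 * root4 R n ^+ 3).
pose K n := nat_above (n%:R * ((S - h) / 2)).
have u0 n : 0 < root4 R n := root4_gt0 R n.
(* The two [isT] work because [nat_above] is a successor, so [K n] and [m n] are positive by
   computation. *)
have codeN n := code n (K n) (m n) (root4 R n ^+ 3) (root4 R n)^-1
  (exprn_gt0 3 (u0 n)) (etrans (invr_gt0 _) (u0 n)) isT isT.
pose E n := sval (cid (codeN n)).
pose D n := sval (cid (svalP (cid (codeN n)))).
have ED n := svalP (cid (svalP (cid (codeN n)))).
(* The error is twice the bound of [error_terms], the 2 being the one of [block_code]. *)
exists m, (fun n => 2 * (V + 4) * (root4 R n)^-1), E, D; split=> //.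
- by move=> n; have [] := ED n.
- move=> n; have [_ _ ] := ED n; apply: le_trans.
  have -> : 2 * (V + 4) * (root4 R n)^-1 = 2 * ((V + 4) / root4 R n) by rewrite mulrA.
  rewrite lerD2l lerN2 ler_pM2l //.
  exact: error_terms.
- rewrite -[X in _ --> X](mulr0 (2 * (V + 4))); apply: cvgM; first exact: cvg_cst.
  exact: cvg_root4V.
- rewrite RBE; apply: cvg_rate.
  by rewrite divr_ge0 // addr_ge0 // (le_trans h0).
Qed.
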